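(* Let $D$ be a division ring that is algebraic over its center $F$, where $F$ is uncountable, let $n\ge 1$, and let $N$ be an almost subnormal subgroup of $\mathrm{GL}_n(D)$. If $N$ satisfies a non-trivial generalized power central group identity, then $N$ is central, i.e. $N\subseteq F$.
   Context: A subgroup $H$ of a group $G$ is almost subnormal in $G$ if there are subgroups $H=H_r\le H_{r-1}\le\cdots\le H_1=G$ such that for each $1<i\le r$, $H_i$ is normal in $H_{i-1}$ or $H_i$ has finite index in $H_{i-1}$. Let $D$ be a division ring with center $F$ and $A=\mathrm{M}_n(D)$, so $A^*=\mathrm{GL}_n(D)$; $F$ is identified with the scalar matrices with entries in $F$, the center of $A$. For a finite set $X=\{x_1,\dots,x_m\}$ of non-commuting indeterminates, $F[X,X^{-1}]$ denotes the group algebra over $F$ of the free group on $X$, and $A_F[X,X^{-1}]=A*_F F[X,X^{-1}]$ is the free product (coproduct) over $F$. A generalized group monomial over $\mathrm{GL}_n(D)$ is an element $w\in A_F[X,X^{-1}]\setminus A$ of the form $w(x_1,\dots,x_m)=a_1x_{i_1}^{n_1}a_2x_{i_2}^{n_2}\cdots a_tx_{i_t}^{n_t}a_{t+1}$ with $a_j\in A^*$, $n_j\in\mathbb{Z}$, $x_{i_j}\in X$. For a subgroup $H$ of $\mathrm{GL}_n(D)$, such a $w$ is a generalized power central group identity (GPCGI) of $H$ (and $H$ satisfies the GPCGI $w$) if for every $(c_1,\dots,c_m)\in H^m$ there is a positive integer $p$, depending on $(c_1,\dots,c_m)$, with $w(c_1,\dots,c_m)^p\in F$. A GPCGI $w$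 is non-trivial if $w^p\in A_F[X,X^{-1}]\setminus A$ for every positive integer $p$. *)

(* Defs.v *)
From HB Require Import structures.
From mathcomp Require Import all_boot all_algebra.
From mathcomp Require Import finmap.
From mathcomp Require Import boolp classical_sets cardinality.
From mathcomp Require Import monalg.

Set Implicit Arguments.
Unset Strict Implicit.
Unset Printing Implicit Defensive.

Import GRing.Theory.
Local Open Scope ring_scope.
Local Open Scope classical_set_scope.

Section FreeGroup.
Variable X : choiceType.

(* The letter (x, false) stands for x and (x, true) for its inverse. *)
Definition letter := (X * bool)%type.
Definition linv (l : letter) : letter := (l.1, ~~ l.2).
Definition reduced (s : seq letter) := sorted (fun l l' => l' != linv l) s.

Definition lcons (l : letter) (s : seq letter) : seq letter :=
  if s is l' :: s' then if l' == linv l then s' else l :: s else [:: l].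
Definition lcat (s t : seq letter) := foldr lcons t s.
Definition lrev (s : seq letter) := rev (map linv s).

Lemma linvK : involutive linv.
Proof. by case=> x b; rewrite /linv /= negbK. Qed.

Lemma reduced_behead l s : reduced (l :: s) -> reduced s.
Proof. by case: s => //= l' s /andP[]. Qed.

Lemma reduced_lcons l s : reduced s -> reduced (lcons l s).
Proof.
case: s => [|l' s] //= rs; case: eqP => [_|/eqP ne]; last by rewrite /= ne rs.
exact: reduced_behead rs.
Qed.

Lemma reduced_lcat s t : reduced t -> reduced (lcat s t).
Proof. by move=> rt; elim: s => //= l s; apply: reduced_lcons. Qed.

Lemma reduced_lrev s : reduced s -> reduced (lrev s).
Proof.
rewrite /reduced /lrev rev_sorted sorted_map; apply: sub_sorted => l l' /=.
by apply: contra => /eqP->; rewrite linvK.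
Qed.

Lemma lcons_linv l s : reduced s -> lcons l (lcons (linv l) s) = s.
Proof.
case: s => [|l' s] /=; first by rewrite eqxx.
rewrite linvK; case: eqP => [->|_] rs; last by rewrite /= eqxx.
by case: s rs => [|l'' s] //= /andP[/negPf-> _].
Qed.

Lemma lcat_lcons l s t : reduced t -> lcat (lcons l s) t = lcons l (lcat s t).
Proof.
move=> rt; case: s => [|l' s] //=; case: eqP => [->|_] //=.
by rewrite lcons_linv //; apply: reduced_lcat.
Qed.

Lemma lcatA s t u : reduced u -> lcat s (lcat t u) = lcat (lcat s t) u.
Proof. by move=> ru; elim: s => //= l s ->; rewrite lcat_lcons. Qed.

Lemma lcats0 s : reduced s -> lcat s [::] = s.
Proof.
elim: s => //= l s IHs rs; rewrite IHs ?(reduced_behead rs) //.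
by case: s rs {IHs} => [|l' s] //= /andP[/negPf-> _].
Qed.

Lemma lcatVs s : lcat (lrev s) s = [::].
Proof.
elim: s => // l s IHs; rewrite /lrev /= rev_cons /lcat foldr_rcons /=.
by rewrite linvK eqxx.
Qed.

Record freegroup := FreeGroup { fgword : seq letter; _ : reduced fgword }.

HB.instance Definition _ := [isSub for fgword].
HB.instance Definition _ := [Choice of freegroup by <:].

Lemma fgwordP (u : freegroup) : reduced (fgword u).
Proof. exact: valP u. Qed.

Definition fg_one : freegroup := @FreeGroup [::] isT.
Definition fg_mul (u v : freegroup) : freegroup :=
  FreeGroup (reduced_lcat (fgword u) (fgwordP v)).
Definition fg_inv (u : freegroup) : freegroup :=
  FreeGroup (reduced_lrev (fgwordP u)).

Lemma fg_mulA : associative fg_mul.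
Proof. by move=> u v w; apply/val_inj/lcatA/fgwordP. Qed.

Lemma fg_mul1 : left_id fg_one fg_mul.
Proof. by move=> u; apply/val_inj. Qed.

Lemma fg_mulr1 : right_id fg_one fg_mul.
Proof. by move=> u; apply/val_inj/lcats0/fgwordP. Qed.

Lemma fg_mulV : left_inverse fg_one fg_inv fg_mul.
Proof. by move=> u; apply/val_inj/lcatVs. Qed.

Lemma fg_invK : involutive fg_inv.
Proof.
move=> u; apply/val_inj; rewrite /= /lrev map_rev revK -map_comp.
by rewrite map_id_in // => l _; apply: linvK.
Qed.

Lemma fg_mulrV : right_inverse fg_one fg_inv fg_mul.
Proof. by move=> u; rewrite -{1}[u]fg_invK fg_mulV. Qed.

HB.instance Definition _ :=
  isGroup.Build freegroup fg_mulA fg_mul1 fg_mulr1 fg_mulV fg_mulrV.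

Definition fg_gen (x : X) : freegroup := @FreeGroup [:: (x, false)] isT.

End FreeGroup.

Section GroupAlgebra.
Variables (R : nzRingType) (G : groupType).

(* Only the additive structure of {malg R[G]} is reused: its product requires  *)
(* a monoid without nontrivial units.                                          *)
Definition galg := {malg R[G]}.
HB.instance Definition _ := GRing.Zmodule.on galg.

Implicit Types g : galg.

Definition galg_one : galg := mkmalgU (1%g : G) (1 : R).
Definition galg_mul g1 g2 : galg :=
  \sum_(k1 <- msupp g1) \sum_(k2 <- msupp g2)
     mkmalgU (k1 * k2)%g (mcoeff k1 g1 * mcoeff k2 g2).

Lemma galg_mulw (d1 d2 : {fset G}) g1 g2 :
  (msupp g1 `<=` d1)%fset -> (msupp g2 `<=` d2)%fset ->
  galg_mul g1 g2 = \sum_(k1 <- d1) \sum_(k2 <- d2)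
     mkmalgU (k1 * k2)%g (mcoeff k1 g1 * mcoeff k2 g2).
Proof.
move=> le_d1 le_d2; rewrite /galg_mul (big_fset_incl _ le_d1) /=.
  apply/eq_bigr=> k1 _; apply/big_fset_incl => // k _ /mcoeff_outdom ->.
  by rewrite mulr0 monalgU0.
move=> k _ /mcoeff_outdom g1k.
by rewrite big1 => // k' _; rewrite g1k mul0r monalgU0.
Qed.

Lemma galg_mulUU c1 c2 k1 k2 :
  galg_mul (mkmalgU k1 c1) (mkmalgU k2 c2) = mkmalgU (k1 * k2)%g (c1 * c2).
Proof. by rewrite (galg_mulw msuppU_le msuppU_le) !big_seq_fset1 !mcoeffUU. Qed.

Lemma galg_mul0g : left_zero 0 galg_mul.
Proof. by move=> g; rewrite /galg_mul msupp0 big_seq_fset0. Qed.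

Lemma galg_mulg0 : right_zero 0 galg_mul.
Proof.
by move=> g; rewrite /galg_mul big1 // => k _; rewrite msupp0 big_seq_fset0.
Qed.

Lemma galg_mulDl : left_distributive galg_mul +%R.
Proof.
move=> g1 g2 g.
rewrite (galg_mulw (msuppD_le g1 g2) (fsubset_refl _)).
rewrite [galg_mul g1 g](galg_mulw (fsubsetUl _ (msupp g2)) (fsubset_refl _)).
rewrite [galg_mul g2 g](galg_mulw (fsubsetUr (msupp g1) _) (fsubset_refl _)).
rewrite -big_split /=; apply/eq_bigr=> k1 _.
rewrite -big_split /=; apply/eq_bigr=> k2 _.
by rewrite mcoeffD mulrDl monalgUD.
Qed.

Lemma galg_mulDr : right_distributive galg_mul +%R.
Proof.
move=> g g1 g2.
rewrite (galg_mulw (fsubset_refl _) (msuppD_le g1 g2)).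
rewrite [galg_mul g g1](galg_mulw (fsubset_refl _) (fsubsetUl _ (msupp g2))).
rewrite [galg_mul g g2](galg_mulw (fsubset_refl _) (fsubsetUr (msupp g1) _)).
rewrite -big_split /=; apply/eq_bigr=> k1 _.
rewrite -big_split /=; apply/eq_bigr=> k2 _.
by rewrite mcoeffD mulrDr monalgUD.
Qed.

Lemma galg_mulEl g1 g2 :
  galg_mul g1 g2 = \sum_(k <- msupp g1) galg_mul (mkmalgU k (mcoeff k g1)) g2.
Proof.
rewrite {1}[g1]monalgE.
by rewrite (big_morph (galg_mul^~ _) (fun _ _ => galg_mulDl _ _ _) (galg_mul0g _)).
Qed.

Lemma galg_mulEr g1 g2 :
  galg_mul g1 g2 = \sum_(k <- msupp g2) galg_mul g1 (mkmalgU k (mcoeff k g2)).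
Proof.
rewrite {1}[g2]monalgE.
by rewrite (big_morph (galg_mul _) (fun _ _ => galg_mulDr _ _ _) (galg_mulg0 _)).
Qed.

Lemma galg_mul1g : left_id galg_one galg_mul.
Proof.
move=> g; rewrite galg_mulEr [RHS]monalgE.
by apply/eq_bigr=> k _; rewrite galg_mulUU mul1r mul1g.
Qed.

Lemma galg_mulg1 : right_id galg_one galg_mul.
Proof.
move=> g; rewrite galg_mulEl [RHS]monalgE.
by apply/eq_bigr=> k _; rewrite galg_mulUU mulr1 mulg1.
Qed.

Lemma galg_mulA : associative galg_mul.
Proof.
have sumr g (I : Type) (r : seq I) (h : I -> galg) :
    galg_mul g (\sum_(i <- r) h i) = \sum_(i <- r) galg_mul g (h i).
  exact: (big_morph _ (fun _ _ => galg_mulDr _ _ _) (galg_mulg0 _)).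
have suml g (I : Type) (r : seq I) (h : I -> galg) :
    galg_mul (\sum_(i <- r) h i) g = \sum_(i <- r) galg_mul (h i) g.
  exact: (big_morph (galg_mul^~ g) (fun _ _ => galg_mulDl _ _ _) (galg_mul0g _)).
move=> g1 g2 g3; rewrite galg_mulEl [galg_mul g1 g2]galg_mulEl suml.
apply/eq_bigr => k1 _; rewrite [galg_mul g2 g3]galg_mulEl sumr.
rewrite [galg_mul _ g2]galg_mulEr suml; apply/eq_bigr => k2 _.
rewrite [galg_mul _ g3]galg_mulEr sumr [RHS]galg_mulEr.
by apply/eq_bigr => k3 _; rewrite !galg_mulUU mulrA mulgA.
Qed.

HB.instance Definition _ := GRing.Zmodule_isPzRing.Build galg
  galg_mulA galg_mul1g galg_mulg1 galg_mulDl galg_mulDr.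

Definition galg_scalar (c : R) : galg := mkmalgU (1%g : G) c.

Lemma galg_scalar_is_zmod : zmod_morphism galg_scalar.
Proof. by move=> c1 c2; apply: monalgUB. Qed.
HB.instance Definition _ :=
  GRing.isZmodMorphism.Build R galg galg_scalar galg_scalar_is_zmod.

Lemma galg_scalar_is_monoid : monoid_morphism galg_scalar.
Proof. by split=> // c1 c2; rewrite [RHS]galg_mulUU mulg1. Qed.
HB.instance Definition _ :=
  GRing.isMonoidMorphism.Build R galg galg_scalar galg_scalar_is_monoid.

Definition galg_of (x : G) : galg := mkmalgU x (1 : R).

End GroupAlgebra.

Section Coproduct.
Variables (F A B : pzRingType).
Variables (f : {rmorphism F -> A}) (g : {rmorphism F -> B}).

(* The pushout of f and g in the category of rings, by generators and         *)
(* relations. When F is commutative and the images of f and g are central, F   *)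
(* is central in the pushout, which is then the coproduct of the F-algebras    *)
(* A and B.                                                                    *)
Inductive cterm :=
  | CInl of A
  | CInr of B
  | CAdd of cterm & cterm
  | COpp of cterm
  | CMul of cterm & cterm.

Inductive ceq : cterm -> cterm -> Prop :=
  | ceq_refl s : ceq s s
  | ceq_sym s t : ceq s t -> ceq t s
  | ceq_trans s t u : ceq s t -> ceq t u -> ceq s u
  | ceq_add s s' t t' : ceq s s' -> ceq t t' -> ceq (CAdd s t) (CAdd s' t')
  | ceq_opp s s' : ceq s s' -> ceq (COpp s) (COpp s')
  | ceq_mul s s' t t' : ceq s s' -> ceq t t' -> ceq (CMul s t) (CMul s' t')
  | ceq_addA s t u : ceq (CAdd s (CAdd t u)) (CAdd (CAdd s t) u)
  | ceq_addC s t : ceq (CAdd s t) (CAdd t s)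
  | ceq_add0 s : ceq (CAdd (CInl 0) s) s
  | ceq_addN s : ceq (CAdd (COpp s) s) (CInl 0)
  | ceq_mulA s t u : ceq (CMul s (CMul t u)) (CMul (CMul s t) u)
  | ceq_mul1 s : ceq (CMul (CInl 1) s) s
  | ceq_mulr1 s : ceq (CMul s (CInl 1)) s
  | ceq_mulDl s t u : ceq (CMul (CAdd s t) u) (CAdd (CMul s u) (CMul t u))
  | ceq_mulDr s t u : ceq (CMul s (CAdd t u)) (CAdd (CMul s t) (CMul s u))
  | ceq_inlD a b : ceq (CInl (a + b)) (CAdd (CInl a) (CInl b))
  | ceq_inlM a b : ceq (CInl (a * b)) (CMul (CInl a) (CInl b))
  | ceq_inrD a b : ceq (CInr (a + b)) (CAdd (CInr a) (CInr b))
  | ceq_inrM a b : ceq (CInr (a * b)) (CMul (CInr a) (CInr b))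
  | ceq_base c : ceq (CInl (f c)) (CInr (g c)).

HB.instance Definition _ := gen_eqMixin cterm.
HB.instance Definition _ := gen_choiceMixin cterm.

Definition ceqb (s t : cterm) : bool := `[< ceq s t >].

Lemma ceqb_equiv : equiv_class_of ceqb.
Proof.
split=> [s|s t|t s u].
- by apply/asboolP/ceq_refl.
- by apply/asboolP/asboolP => /ceq_sym.
- by move=> /asboolP st /asboolP tu; apply/asboolP/(ceq_trans st tu).
Qed.
Canonical ceqb_equiv_rel := EquivRelPack ceqb_equiv.

Definition coprod := {eq_quot ceqb}%qT.
HB.instance Definition _ := Choice.on coprod.

Definition cclass (s : cterm) : coprod := \pi_coprod%qT s.

Lemma cclassP s t : cclass s = cclass t <-> ceq s t.
Proof. by split=> [/eqquotP/asboolP|st]; last exact/eqquotP/asboolP. Qed.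

Lemma crepr_ceq s : ceq (repr (cclass s)) s.
Proof. by apply/cclassP; rewrite /cclass reprK. Qed.

Definition coprod_add (x y : coprod) := cclass (CAdd (repr x) (repr y)).
Definition coprod_mul (x y : coprod) := cclass (CMul (repr x) (repr y)).
Definition coprod_opp (x : coprod) := cclass (COpp (repr x)).

Definition coprod_inl (a : A) := cclass (CInl a).
Definition coprod_inr (b : B) := cclass (CInr b).

Lemma cclassD s t : cclass (CAdd s t) = coprod_add (cclass s) (cclass t).
Proof. by apply/cclassP/ceq_sym/ceq_add; apply: crepr_ceq. Qed.

Lemma cclassM s t : cclass (CMul s t) = coprod_mul (cclass s) (cclass t).
Proof. by apply/cclassP/ceq_sym/ceq_mul; apply: crepr_ceq. Qed.

Lemma cclassN s : cclass (COpp s) = coprod_opp (cclass s).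
Proof. by apply/cclassP/ceq_sym/ceq_opp; apply: crepr_ceq. Qed.

Lemma cclass_surj (x : coprod) : exists s, x = cclass s.
Proof. by exists (repr x); rewrite /cclass reprK. Qed.

Lemma coprod_addA : associative coprod_add.
Proof.
move=> x y z; have [s ->] := cclass_surj x; have [t ->] := cclass_surj y; have [u ->] := cclass_surj z;
by rewrite -?(cclassD, cclassM, cclassN); apply/cclassP/ceq_addA.
Qed.

Lemma coprod_addC : commutative coprod_add.
Proof.
move=> x y; have [s ->] := cclass_surj x; have [t ->] := cclass_surj y;
by rewrite -?(cclassD, cclassM, cclassN); apply/cclassP/ceq_addC.
Qed.

Lemma coprod_add0 : left_id (coprod_inl 0) coprod_add.
Proof.
move=> x; have [s ->] := cclass_surj x;
by rewrite -?(cclassD, cclassM, cclassN); apply/cclassP/ceq_add0.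
Qed.

Lemma coprod_addN : left_inverse (coprod_inl 0) coprod_opp coprod_add.
Proof.
move=> x; have [s ->] := cclass_surj x;
by rewrite -?(cclassD, cclassM, cclassN); apply/cclassP/ceq_addN.
Qed.

Lemma coprod_mulA : associative coprod_mul.
Proof.
move=> x y z; have [s ->] := cclass_surj x; have [t ->] := cclass_surj y; have [u ->] := cclass_surj z;
by rewrite -?(cclassD, cclassM, cclassN); apply/cclassP/ceq_mulA.
Qed.

Lemma coprod_mul1 : left_id (coprod_inl 1) coprod_mul.
Proof.
move=> x; have [s ->] := cclass_surj x;
by rewrite -?(cclassD, cclassM, cclassN); apply/cclassP/ceq_mul1.
Qed.

Lemma coprod_mulr1 : right_id (coprod_inl 1) coprod_mul.
Proof.
move=> x; have [s ->] := cclass_surj x;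
by rewrite -?(cclassD, cclassM, cclassN); apply/cclassP/ceq_mulr1.
Qed.

Lemma coprod_mulDl : left_distributive coprod_mul coprod_add.
Proof.
move=> x y z; have [s ->] := cclass_surj x; have [t ->] := cclass_surj y; have [u ->] := cclass_surj z;
by rewrite -?(cclassD, cclassM, cclassN); apply/cclassP/ceq_mulDl.
Qed.

Lemma coprod_mulDr : right_distributive coprod_mul coprod_add.
Proof.
move=> x y z; have [s ->] := cclass_surj x; have [t ->] := cclass_surj y; have [u ->] := cclass_surj z;
by rewrite -?(cclassD, cclassM, cclassN); apply/cclassP/ceq_mulDr.
Qed.

HB.instance Definition _ := GRing.isPzRing.Build coprod
  coprod_addA coprod_addC coprod_add0 coprod_addN coprod_mulA
  coprod_mul1 coprod_mulr1 coprod_mulDl coprod_mulDr.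

Lemma coprod_base c : coprod_inl (f c) = coprod_inr (g c).
Proof. exact/cclassP/ceq_base. Qed.

Lemma coprod_inl_is_nmod : nmod_morphism coprod_inl.
Proof. split=> // a b.
by rewrite -[RHS]/(coprod_add (cclass _) (cclass _)) -cclassD; apply/cclassP/ceq_inlD. Qed.
HB.instance Definition _ :=
  GRing.isNmodMorphism.Build A coprod coprod_inl coprod_inl_is_nmod.

Lemma coprod_inl_is_monoid : monoid_morphism coprod_inl.
Proof. split=> // a b.
by rewrite -[RHS]/(coprod_mul (cclass _) (cclass _)) -cclassM; apply/cclassP/ceq_inlM. Qed.
HB.instance Definition _ :=
  GRing.isMonoidMorphism.Build A coprod coprod_inl coprod_inl_is_monoid.

Lemma coprod_inr_is_nmod : nmod_morphism coprod_inr.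
Proof.
split=> [|a b]; first by rewrite -(rmorph0 g) -coprod_base rmorph0.
by rewrite -[RHS]/(coprod_add (cclass _) (cclass _)) -cclassD; apply/cclassP/ceq_inrD.
Qed.
HB.instance Definition _ :=
  GRing.isNmodMorphism.Build B coprod coprod_inr coprod_inr_is_nmod.

Lemma coprod_inr_is_monoid : monoid_morphism coprod_inr.
Proof.
split=> [|a b]; first by rewrite -(rmorph1 g) -coprod_base rmorph1.
by rewrite -[RHS]/(coprod_mul (cclass _) (cclass _)) -cclassM; apply/cclassP/ceq_inrM.
Qed.
HB.instance Definition _ :=
  GRing.isMonoidMorphism.Build B coprod coprod_inr coprod_inr_is_monoid.

Section Lift.
Variables (S : pzRingType) (h : {rmorphism A -> S}) (k : {rmorphism B -> S}).
Hypothesis hk : forall c, h (f c) = k (g c).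

Fixpoint cterm_val (t : cterm) : S :=
  match t with
  | CInl a => h a
  | CInr b => k b
  | CAdd s t => cterm_val s + cterm_val t
  | COpp s => - cterm_val s
  | CMul s t => cterm_val s * cterm_val t
  end.

Lemma ceq_val s t : ceq s t -> cterm_val s = cterm_val t.
Proof.
elim=> //=; intros;
  by [congruence | rewrite ?(addrA, rmorph0, add0r, addNr, mulrA, rmorph1,
    mul1r, mulr1, mulrDl, mulrDr, rmorphD, rmorphM) // addrC].
Qed.

Lemma coprod_univ : exists! u : coprod -> S,
  [/\ zmod_morphism u, monoid_morphism u,
      (forall a, u (coprod_inl a) = h a) & (forall b, u (coprod_inr b) = k b)].
Proof.
pose u (x : coprod) := cterm_val (repr x).
have uE s : u (cclass s) = cterm_val s by apply/ceq_val/crepr_ceq.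
exists u; split=> [|v [vB [v1 vM] vl vr]]; last first.
  apply/funext => x; have [s ->] := cclass_surj x; rewrite uE.
  have v0 : v 0 = 0 by rewrite -[0 in LHS](subrr 0) vB subrr.
  have vN y : v (- y) = - v y by rewrite -sub0r vB v0 sub0r.
  have vD y z : v (y + z) = v y + v z by rewrite -{1}[z]opprK vB vN opprK.
  elim: s => [a|b|s IHs t IHt|s IHs|s IHs t IHt] /=.
  - by rewrite -vl.
  - by rewrite -vr.
  - by rewrite IHs IHt cclassD -vD.
  - by rewrite IHs cclassN -vN.
  - by rewrite IHs IHt cclassM -vM.
split=> [x y||a|b]; last 2 first.
- exact: uE.
- exact: uE.
- have [s ->] := cclass_surj x; have [t ->] := cclass_surj y.
  by rewrite -[_ - _]/(coprod_add _ (coprod_opp _)) -cclassN -cclassD !uE.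
split=> [|x y]; first by rewrite -[1]/(coprod_inl 1) uE /= rmorph1.
have [s ->] := cclass_surj x; have [t ->] := cclass_surj y.
by rewrite -[_ * _]/(coprod_mul _ _) -cclassM !uE.
Qed.

End Lift.
End Coproduct.

Section Units.
Variable A : pzRingType.

Definition is_unit (a : A) : bool := `[< exists b, a * b = 1 /\ b * a = 1 >].

(* MathComp has unit groups of finite rings only, and no unitRingType          *)
(* structure on matrices over a noncommutative ring.                           *)
Record units := Units { uval : A; _ : is_unit uval }.

HB.instance Definition _ := [isSub for uval].
HB.instance Definition _ := [Choice of units by <:].

Lemma is_unitP (x : units) : {b | uval x * b = 1 /\ b * uval x = 1}.
Proof. by apply: cid; case: x => a /= /asboolP. Qed.

Definition uinv_val (x : units) : A := sval (is_unitP x).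

Lemma uval_mulV (x : units) : uval x * uinv_val x = 1.
Proof. by rewrite /uinv_val; case: is_unitP => b []. Qed.

Lemma uval_mulVl (x : units) : uinv_val x * uval x = 1.
Proof. by rewrite /uinv_val; case: is_unitP => b []. Qed.

Lemma is_unit1 : is_unit 1.
Proof. by apply/asboolP; exists 1; rewrite mulr1. Qed.

Lemma is_unitM (x y : units) : is_unit (uval x * uval y).
Proof.
apply/asboolP; exists (uinv_val y * uinv_val x); split.
  by rewrite mulrA -(mulrA (uval x)) uval_mulV mulr1 uval_mulV.
by rewrite mulrA -(mulrA (uinv_val y)) uval_mulVl mulr1 uval_mulVl.
Qed.

Lemma is_unitV (x : units) : is_unit (uinv_val x).
Proof. by apply/asboolP; exists (uval x); rewrite uval_mulV uval_mulVl. Qed.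

Definition units_one : units := Units is_unit1.
Definition units_mul (x y : units) : units := Units (is_unitM x y).
Definition units_inv (x : units) : units := Units (is_unitV x).

Lemma units_mulA : associative units_mul.
Proof. by move=> x y z; apply/val_inj/mulrA. Qed.
Lemma units_mul1 : left_id units_one units_mul.
Proof. by move=> x; apply/val_inj/mul1r. Qed.
Lemma units_mulr1 : right_id units_one units_mul.
Proof. by move=> x; apply/val_inj/mulr1. Qed.
Lemma units_mulV : left_inverse units_one units_inv units_mul.
Proof. by move=> x; apply/val_inj/uval_mulVl. Qed.
Lemma units_mulrV : right_inverse units_one units_inv units_mul.
Proof. by move=> x; apply/val_inj/uval_mulV. Qed.

HB.instance Definition _ := isGroup.Build units
  units_mulA units_mul1 units_mulr1 units_mulV units_mulrV.

End Units.

Section Subgroups.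
Variable G : groupType.
Local Open Scope group_scope.
Local Open Scope classical_set_scope.
Implicit Types H K : set G.

Definition subgroup H : Prop := group_closed (mem H).

Definition normal_in H K : Prop :=
  H `<=` K /\ forall h k, H h -> K k -> H (h ^ k).

Definition finite_index H K : Prop :=
  H `<=` K /\ finite_set [set [set x * h | h in H] | x in K].

(* The chain H_1, ..., H_r is indexed from 0: K i stands for H_{i+1}.          *)
Definition almost_subnormal H : Prop :=
  exists (r : nat) (K : nat -> set G),
    [/\ K 0%N = setT, K r = H,
        forall i, (i <= r)%N -> subgroup (K i) &
        forall i, (i < r)%N ->
          normal_in (K i.+1) (K i) \/ finite_index (K i.+1) (K i)].

Definition expgz (x : G) (n : int) : G :=
  match n with Posz k => x ^+ k | Negz k => x ^- k.+1 end.

End Subgroups.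

Section GeneralizedMonomials.
Variables (F : fieldType) (D : unitAlgType F) (n m : nat).

Notation A := 'M[D]_n.
Notation GL := (units A).

Definition scalar_in (k : F) : A := (k%:A)%:M.

Lemma scalar_in_is_zmod : zmod_morphism scalar_in.
Proof. by move=> a b; rewrite /scalar_in scalerBl raddfB. Qed.
HB.instance Definition _ :=
  GRing.isZmodMorphism.Build F A scalar_in scalar_in_is_zmod.

Lemma scalar_in_is_monoid : monoid_morphism scalar_in.
Proof.
split=> [|a b]; first by rewrite /scalar_in scale1r.
by rewrite /scalar_in -[LHS]/((in_alg D (a * b))%:M) rmorphM /= scalar_mxM.
Qed.
HB.instance Definition _ :=
  GRing.isMonoidMorphism.Build F A scalar_in scalar_in_is_monoid.

Definition free_grp := freegroup 'I_m.

Definition genA := coprod scalar_in (galg_scalar free_grp).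
Definition constA : A -> genA := coprod_inl _ _.
Definition grpA (u : free_grp) : genA := coprod_inr _ _ (galg_of F u).

(* a_1 x_{i_1}^{n_1} ... a_t x_{i_t}^{n_t} a_{t+1}: the list of the triples     *)
(* (a_j, i_j, n_j), and a_{t+1}.                                               *)
Record gmon := GMon { gfactors : seq (GL * 'I_m * int); glast : GL }.

Definition gmon_elt (w : gmon) : genA :=
  (\prod_(s <- gfactors w)
     (constA (uval s.1.1) * grpA (expgz (fg_gen s.1.2) s.2)))
  * constA (uval (glast w)).

Definition gmon_eval (w : gmon) (c : 'I_m -> GL) : GL :=
  ((\prod_(s <- gfactors w) (s.1.1 * expgz (c s.1.2) s.2)) * glast w)%g.

Definition gen_monomial (w : gmon) : Prop := forall a : A, gmon_elt w <> constA a.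

Definition central_mx (a : A) : Prop := exists k : F, a = scalar_in k.

Definition GPCGI (H : set GL) (w : gmon) : Prop :=
  gen_monomial w /\
  forall c : 'I_m -> GL, (forall i, H (c i)) ->
    exists2 p, (0 < p)%N & central_mx (uval (gmon_eval w c) ^+ p).

Definition nontrivial_gmon (w : gmon) : Prop :=
  forall p, (0 < p)%N -> forall a : A, gmon_elt w ^+ p <> constA a.

End GeneralizedMonomials.

Definition ring_center (R : pzRingType) : set R :=
  [set x | forall y, x * y = y * x].
Arguments ring_center R : clear implicits.

Definition division_ring (D : unitRingType) : Prop :=
  forall x : D, x != 0 -> x \is a GRing.unit.

Definition is_algebraic (F : fieldType) (D : unitAlgType F) : Prop :=
  forall x : D, exists2 p : {poly F}, p != 0 & root (map_poly (in_alg D) p) x.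

(* Main.v *)
Require Import Defs.
From mathcomp Require Import all_boot all_algebra.
From mathcomp Require Import finmap.
From mathcomp Require Import boolp classical_sets cardinality.
From mathcomp Require Import monalg.

(* Let A = M_n(D). If N contains a noncentral element, substituting suitable  *)
(* iterated commutators and powers for the variables turns a nontrivial       *)
(* identity of N into an identity of the whole of A^*, in one variable x and  *)
(* with noncentral coefficients between consecutive letters x^{+-1}. Such a   *)
(* word is evaluated along a polynomial curve s(t), with t in F. As F is      *)
(* uncountable, one and the same power of the value is central for infinitely *)
(* many t, so this power is a central polynomial in t. But the curve is       *)
(* chosen to degenerate, at t = 0 or at t = u with u in D algebraic over F,   *)
(* to an operator of rank one: there the word becomes an operator that is     *)
(* neither nilpotent nor injective, whereas a central polynomial acts there   *)
(* as zero or injectively. For n > 1 the curve is t + nu with nu of square    *)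
(* zero and rank one; for n = 1 it is (u - t)^-1 gamma (u - t), whose pole at *)
(* the roots of the minimal polynomial of u supplies the operator of rank     *)
(* one.                                                                       *)

Set Implicit Arguments.
Unset Strict Implicit.
Unset Printing Implicit Defensive.

Import GRing.Theory.
Local Open Scope ring_scope.
Local Open Scope classical_set_scope.

(** A noncentral [a] in [N] is incompatible with the identity. Power-centrality is invariant under
    cyclic conjugation, so [cyclic_reduction] replaces the monomial, in A_F[X,X^-1] and under all
    evaluations at once, by a constant or by a nonempty cyclically reduced word. A constant has a
    central power, as evaluation at [a] shows, and then so has the formal monomial, against
    non-triviality.

    For a reduced word, [open_word_almost_subnormal] descends the subnormal chain by commutators
    with [a] and by powers, and finds an open word f such that f(x) a^-1 lies in [N] for every unit
    x. Inserting generically conjugated products of such elements ([generic_substitution]) keeps all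
    inner coefficients noncentral, and the monomial becomes, up to conjugation, f(x) d with f open
    and d noncentral. By [open_word_not_power_central] some value of this has no central power,
    provided that a degeneration exists. It comes from a rank-one idempotent when n > 1
    ([degeneration_idempotent]) and from the minimal polynomial of an element of D when n = 1
    ([degeneration_division]). *)

(** * Polynomials over a noncommutative ring acting at a point *)

Section Act.
Variable A : nzRingType.
Implicit Types (u m : A) (P Q : {poly A}).

(** Evaluation at a noncentral [u] is not multiplicative. Instead A becomes a left A[X]-module where
    constants multiply on the left and 'X multiplies on the right by [u]; [hornerM_act] is the
    resulting product rule. *)
Definition act u P m : A := (P * m%:P).[u].

Lemma hornerM_act P Q u : (P * Q).[u] = act u P Q.[u].
Proof.
rewrite /act; elim/poly_ind: P => [|P c IH]; first by rewrite !mul0r !horner0.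
rewrite !mulrDl !hornerD !hornerCM -!mulrA -!commr_polyX !mulrA !hornerMX IH.
by rewrite hornerC.
Qed.

Lemma actM u P Q m : act u (P * Q) m = act u P (act u Q m).
Proof. by rewrite {1}/act -mulrA hornerM_act. Qed.

Lemma actC u a m : act u a%:P m = a * m.
Proof. by rewrite /act hornerCM hornerC. Qed.

Lemma act0 u P : act u P 0 = 0.
Proof. by rewrite /act polyC0 mulr0 horner0. Qed.

Lemma actD u P m1 m2 : act u P (m1 + m2) = act u P m1 + act u P m2.
Proof. by rewrite /act polyCD mulrDr hornerD. Qed.

Lemma actBl u P Q m : act u (P - Q) m = act u P m - act u Q m.
Proof. by rewrite /act mulrBl hornerD hornerN. Qed.

Lemma actX u m : act u 'X m = m * u.
Proof. by rewrite /act -commr_polyX hornerMX hornerC. Qed.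

Lemma actMr u P m e : e * u = u * e -> act u P (m * e) = act u P m * e.
Proof.
move=> eu; rewrite /act polyCM mulrA; move: (P * m%:P) => Q.
elim/poly_ind: Q => [|Q c IH]; first by rewrite mul0r !horner0 mul0r.
rewrite mulrDl -mulrA -commr_polyX mulrA !hornerMXaddC hornerD hornerMX IH.
by rewrite -polyCM hornerC mulrDl -!mulrA eu.
Qed.

End Act.

(** * Evaluation and roots at central scalars *)

Section CentralScalars.
Variables (F : fieldType) (A : nzRingType) (iota : {rmorphism F -> A}).
Hypothesis iotaC : forall k a, iota k * a = a * iota k.
Implicit Types (u m : A) (P Q : {poly A}) (q : {poly F}).

Lemma map_iota_comm q P : map_poly iota q * P = P * map_poly iota q.
Proof.
elim/poly_ind: q => [|q c IH]; first by rewrite rmorph0 mul0r mulr0.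
rewrite rmorphD rmorphM /= map_polyX map_polyC /= mulrDl mulrDr; congr (_ + _).
  by rewrite -mulrA -commr_polyX mulrA IH mulrA.
apply/polyP => i; rewrite coefCM coefMC; exact: iotaC.
Qed.

Lemma act_map_iota u q m :
  act u (map_poly iota q) m = m * (map_poly iota q).[u].
Proof. by rewrite /act map_iota_comm hornerCM. Qed.

Lemma act_iota k P m : act (iota k) P m = P.[iota k] * m.
Proof. by rewrite /act hornerM_comm ?hornerC // /comm_poly hornerC iotaC. Qed.

Lemma hornerM_iota k P Q : (P * Q).[iota k] = P.[iota k] * Q.[iota k].
Proof. by rewrite hornerM_act act_iota. Qed.

Lemma hornerX_iota k P p : (P ^+ p).[iota k] = P.[iota k] ^+ p.
Proof.
by elim: p => [|p IH]; rewrite ?expr0 ?hornerC // !exprS hornerM_iota IH.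
Qed.

Lemma iota_cancel k a : k != 0 -> iota k * a = 0 -> a = 0.
Proof.
move=> k0 ka; rewrite -[a]mul1r -(rmorph1 iota) -(mulVf k0) rmorphM -mulrA ka.
by rewrite mulr0.
Qed.

(** Evaluation at a central scalar is multiplicative and nonzero scalars cancel, so the commutative
    root count survives for central roots. *)
Lemma central_roots_eq0 P (r : seq F) : uniq r ->
  {in r, forall k, P.[iota k] = 0} -> (size P <= size r)%N -> P = 0.
Proof.
elim: r P => [|k r IH] P /=; first by rewrite leqn0 size_poly_eq0 => _ _ /eqP.
move=> /andP[kr ur] Pr; have /factor_theorem[Q PQ] : root P (iota k).
  by apply/eqP/Pr; rewrite mem_head.
have [Q0|Q0] := eqVneq Q 0; first by rewrite PQ Q0 mul0r.
rewrite {1}PQ size_Mmonic ?monicXsubC // size_XsubC addn2 /= ltnS => szQ.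
suff Q_eq0 : Q = 0 by rewrite Q_eq0 eqxx in Q0.
apply: IH => // k' k'r; apply: (@iota_cancel (k' - k)).
  by rewrite subr_eq0; apply: contraNneq kr => <-.
have := Pr k'; rewrite inE k'r orbT => /(_ isT); rewrite PQ hornerM_iota.
by rewrite hornerXsubC -rmorphB -iotaC.
Qed.

Lemma finite_central_roots P :
  P != 0 -> finite_set [set k | P.[iota k] = 0].
Proof.
move=> P0; apply: contrapT => /(infinite_set_fset (size P))[B sB leB].
move/eqP: P0; apply; apply: (central_roots_eq0 (fset_uniq B)) => [k /sB|] //.
Qed.

Lemma finite_roots_seq (Ps : seq {poly A}) : {in Ps, forall P, P != 0} ->
  finite_set [set k | exists2 P, P \in Ps & P.[iota k] = 0].
Proof.
elim: Ps => [|P Ps IH] nzPs.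
  by rewrite (_ : mkset _ = set0) //; apply/seteqP; split => k //= [].
apply: (@sub_finite_set _ _
  ([set k | P.[iota k] = 0]
   `|` [set k | exists2 P, P \in Ps & P.[iota k] = 0])%classic).
  by move=> k [Q]; rewrite inE => /orP[/eqP->|QPs] Qk; [left|right; exists Q].
rewrite finite_setU; split; first by apply/finite_central_roots/nzPs/mem_head.
by apply: IH => Q QPs; apply: nzPs; rewrite inE QPs orbT.
Qed.

Hypothesis Finf : infinite_set [set: F].

Lemma central_nonroot (Ps : seq {poly A}) : {in Ps, forall P, P != 0} ->
  exists k, {in Ps, forall P, P.[iota k] <> 0}.
Proof.
move=> /finite_roots_seq fin; apply: contrapT => noroot; apply: Finf.
apply: sub_finite_set fin => k _ /=; apply: contrapT => nk; apply: noroot.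
by exists k => P PPs Pk; apply: nk; exists P.
Qed.

(* Along a line in the F-space A, each of the maps fails at finitely many     *)
(* points only.                                                               *)
Lemma common_nonzero (I : eqType) (J : seq I) (t : I -> A -> A) :
  (forall i k x y, t i (x + iota k * y) = t i x + iota k * t i y) ->
  {in J, forall i, exists x, t i x <> 0} ->
  exists x, {in J, forall i, t i x <> 0}.
Proof.
move=> lin; elim: J => [|i J IH] HJ; first by exists 0.
have [j jJ|x Hx] := IH; first by apply: HJ; rewrite inE jJ orbT.
have [y tiy] := HJ i (mem_head _ _).
pose Q j := (t j x)%:P + (t j y)%:P * 'X.
have QE j k : (Q j).[iota k] = t j (x + iota k * y).
  by rewrite lin /Q hornerD hornerC hornerMX hornerC iotaC.
have [|k Hk] := @central_nonroot [seq Q j | j <- i :: J]; last first.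
  by exists (x + iota k * y) => j jJ; rewrite -QE; apply/Hk/map_f.
move=> _ /mapP[j jJ ->]; apply/eqP => /polyP Q0.
move: jJ; rewrite inE => /predU1P[ji|/Hx []].
  by apply: tiy; have := Q0 1; rewrite coefD coefC coefMX coefC add0r coef0 ji.
by have := Q0 0; rewrite coefD coefC coefMX addr0 coef0.
Qed.

End CentralScalars.

(** * Values of units *)

Section UnitValues.
Variable A : pzRingType.
Implicit Types x y : units A.

Lemma uvalM x y : uval (x * y)%g = uval x * uval y. Proof. by []. Qed.
Lemma uval1 : uval (1%g : units A) = 1. Proof. by []. Qed.

Lemma uvalVr x : uval x * uval x^-1%g = 1. Proof. exact: uval_mulV. Qed.
Lemma uvalVl x : uval x^-1%g * uval x = 1. Proof. exact: uval_mulVl. Qed.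

Lemma uval_cancel x a : uval x * a = 0 -> a = 0.
Proof. by move=> xa; rewrite -[a]mul1r -(uvalVl x) -mulrA xa mulr0. Qed.

Lemma uvalX x p : uval (x ^+ p)%g = uval x ^+ p.
Proof. by elim: p => // p IH; rewrite exprS -IH expgS. Qed.

End UnitValues.

(** * Open words along degenerating polynomial curves *)

Section OpenWords.
Variables (F : fieldType) (A : nzRingType) (iota : {rmorphism F -> A}).
Hypothesis iotaC : forall k a, iota k * a = a * iota k.
Notation G := (units A).
Notation central a := (exists k, a = iota k).

(* Words in x that begin and end with x or x^-1 and whose inner coefficients  *)
(* are noncentral.                                                            *)
Inductive open_word : (G -> G) -> Prop :=
| open_id : open_word id
| open_inv f : open_word f -> open_word (fun x => (f x)^-1)%g
| open_mul f b g : open_word f -> open_word g -> ~ central (uval b) ->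
    open_word (fun x => f x * b * g x)%g.

Lemma centralV (b : G) : central (uval b) -> central (uval b^-1%g).
Proof.
move=> [k bk]; have k0 : k != 0.
  by apply: contraTneq (oner_neq0 A) => k0; rewrite -(uvalVr b) bk k0 rmorph0
    mul0r negbK.
exists k^-1; rewrite -[LHS]mul1r -(rmorph1 iota) -(mulVf k0) rmorphM -mulrA.
by rewrite -bk uvalVr mulr1.
Qed.

Lemma noncentralV (b : G) : ~ central (uval b) -> ~ central (uval b^-1%g).
Proof. by move=> nb /centralV; rewrite invgK. Qed.

Lemma centralJ (b g : G) : central (uval (g^-1 * b * g)%g) -> central (uval b).
Proof.
move=> [k bk]; exists k.
have -> : b = (g * (g^-1 * b * g) * g^-1)%g by rewrite !mulgA mulgV mul1g mulgK.
by rewrite 2!uvalM bk -iotaC -mulrA uvalVr mulr1.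
Qed.

(** The inner coefficients are merely conjugated by [g], hence stay noncentral. *)
Lemma open_conj f (g : G) : open_word f ->
  open_word (fun x => g^-1 * f (g * x * g^-1) * g)%g.
Proof.
elim=> [|{}f _ IH|{}f b h _ IHf _ IHh nb].
- by rewrite (_ : (fun x => _) = id); [exact: open_id | apply: funext => x;
    rewrite !mulgA mulVg mul1g mulgVK].
- rewrite (_ : (fun x => _) = fun x => (g^-1 * f (g * x * g^-1) * g)^-1)%g;
    first exact: open_inv.
  by apply: funext => x; rewrite !invgM invgK mulgA.
rewrite (_ : (fun x => _) = fun x => (g^-1 * f (g * x * g^-1) * g)
    * (g^-1 * b * g) * (g^-1 * h (g * x * g^-1) * g))%g; last first.
  by apply: funext => x; rewrite !mulgA !mulgK.
by apply: open_mul => // /centralJ.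
Qed.

(* A polynomial curve s in A, invertible where phi does not vanish, together  *)
(* with a place u at which s and phi s^-1 degenerate (their kernels are       *)
(* nonzero) in such a way that products with coefficients in B do not vanish  *)
(* (L is stable).                                                             *)
Record degeneration (B : seq G) (u : A) (s s' : {poly A}) (phi : {poly F})
    (L : A -> Prop) : Prop := Degeneration {
  deg_neq0 : phi != 0;
  deg_mulr : s * s' = map_poly iota phi;
  deg_mull : s' * s = map_poly iota phi;
  deg_place : forall q, (map_poly iota q).[u] = 0 \/
    forall m, m * (map_poly iota q).[u] = 0 -> m = 0;
  deg_nonempty : exists m, L m;
  deg_nonzero : ~ L 0;
  deg_stable : {in B, forall b m, L m -> L (act u s (uval b * m))};
  deg_stableV : {in B, forall b m, L m -> L (act u s' (uval b * m))};
  deg_ker : exists2 m, m <> 0 & act u s m = 0;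
  deg_kerV : exists2 m, m <> 0 & act u s' m = 0 }.

Section Interpolation.
Variables (B : seq G) (u : A) (s s' : {poly A}) (phi : {poly F}).
Variable L : A -> Prop.
Hypothesis sep : degeneration B u s s' phi L.

(** [P] is the value of [f] along the curve, with its denominator cleared by a power of phi. Its
    action at [u] preserves [L] after any coefficient in [B], but is not injective. *)
Record interpolates (f : G -> G) (P : {poly A}) : Prop := Interpolates {
  interp_eval : exists k, forall t x, phi.[t] != 0 -> uval x = s.[iota t] ->
    P.[iota t] = iota (phi.[t] ^+ k) * uval (f x);
  interp_stable : {in B, forall b m, L m -> L (act u P (uval b * m))};
  interp_ker : exists2 m, m <> 0 & act u P m = 0 }.

Lemma interpolates_id : interpolates id s.
Proof.
split; [|exact: deg_stable sep|exact: deg_ker sep].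
by exists 0 => t x _ ->; rewrite expr0 rmorph1 mul1r.
Qed.

Lemma interpolates_inv : interpolates (fun x => x^-1)%g s'.
Proof.
split; [|exact: deg_stableV sep|exact: deg_kerV sep].
exists 1 => t x _ xs; rewrite expr1 -[LHS]mulr1 -(uvalVr x) mulrA xs.
by rewrite -hornerM_iota // (deg_mull sep) horner_map.
Qed.

Lemma interpolates_mul f b g P Q : interpolates f P -> interpolates g Q ->
  b \in B -> interpolates (fun x => f x * b * g x)%g (P * (uval b)%:P * Q).
Proof.
move=> [[k Pk] PL _] [[l Ql] QL [m m0 Qm]] bB; split.
- exists (k + l)%N => t x t0 xs; rewrite !hornerM_iota // hornerC (Pk t x) //
    (Ql t x) //.
  rewrite exprD rmorphM !uvalM -!mulrA; congr (_ * _).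
  by rewrite !mulrA -(iotaC (phi.[t] ^+ l)) !mulrA.
- by move=> c cB y Ly; rewrite !actM actC; apply/PL/QL.
by exists m => //; rewrite actM Qm act0.
Qed.

End Interpolation.

(** [B] collects the inner coefficients and their inverses, before any curve is given, because the
    curve must be adapted to them. The word and its inverse go through the induction together, since
    [open_inv] exchanges them. *)
Lemma interpolation f : open_word f -> exists B : seq G,
  {in B, forall b, ~ central (uval b)} /\
  forall B' u s s' phi L, {subset B <= B'} -> degeneration B' u s s' phi L ->
    (exists P, interpolates B' u s phi L f P) /\
    (exists P, interpolates B' u s phi L (fun x => (f x)^-1)%g P).
Proof.
elim=> [|{}f _ [B [nB HB]]|{}f b g _ [B [nB HB]] _ [C [nC HC]] nb].
- exists [::]; split=> // B' u s s' phi L _ sep; split.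
    by exists s; apply: interpolates_id sep.
  by exists s'; apply: interpolates_inv sep.
- exists B; split=> // B' u s s' phi L sBB' sep.
  have [Hf Hf'] := HB _ _ _ _ _ _ sBB' sep; split=> //.
  by rewrite (_ : (fun x => _) = f) //; apply: funext => x; rewrite invgK.
exists [:: b, b^-1%g & B ++ C]; split.
  move=> c; rewrite !inE mem_cat => /or4P[/eqP->|/eqP->|/nB|/nC] //.
  exact: noncentralV.
move=> B' u s s' phi L sB' sep.
have [] := HB B' u s s' phi L; first by move=> c cB; apply: sB';
  rewrite !inE mem_cat cB !orbT.
  by [].
have [] := HC B' u s s' phi L; first by move=> c cC; apply: sB';
  rewrite !inE mem_cat cC !orbT.
  by [].
move=> [Q HQ] [Q' HQ'] [P HP] [P' HP']; split.
  by eexists; apply: (interpolates_mul HP HQ); apply: sB'; rewrite mem_head.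
rewrite (_ : (fun x => _) = fun x => (g x)^-1 * b^-1 * (f x)^-1)%g; last first.
  by apply: funext => x; rewrite !invgM !mulgA.
by eexists; apply: (interpolates_mul HQ' HP'); apply: sB';
  rewrite !inE eqxx orbT.
Qed.

Hypothesis centerP : forall a, (forall y, a * y = y * a) -> central a.
Hypothesis Func : ~ countable [set: F].

Lemma act_expr (u m : A) P p :
  act u P m = 0 -> (0 < p)%N -> act u (P ^+ p) m = 0.
Proof. by case: p => // p Pm _; rewrite exprSr actM Pm act0. Qed.

(* The exponent p may depend on the parameter t, but one p serves infinitely  *)
(* many t since F is uncountable; then P^p is a polynomial over F, which acts *)
(* at the place u as zero or injectively.                                     *)
Lemma open_word_not_power_central f (d : G) :
  (forall (b0 : G) B, {in b0 :: B, forall b, ~ central (uval b)} ->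
    exists u s s' phi L, degeneration (b0 :: B) u s s' phi L) ->
  open_word f -> ~ central (uval d) ->
  exists x, forall p, (0 < p)%N -> ~ central (uval (f x * d)%g ^+ p).
Proof.
move=> deg /interpolation[B [nB HB]] nd; apply: contrapT => noex.
have [|u [s [s' [phi [L sep]]]]] := deg d B.
  by move=> b; rewrite inE => /predU1P[->//|/nB].
have [] := HB (d :: B) u s s' phi L; first by move=> b bB; rewrite inE bB orbT.
  by [].
move=> [P [[k Pk] PL [m0 m0_neq0 Pm0]]] _.
pose Q := P * (uval d)%:P.
have Qpc t : phi.[t] != 0 -> exists2 p, (0 < p)%N & central (Q.[iota t] ^+ p).
  move=> t0; have ut : is_unit s.[iota t].
    apply/asboolP; exists (iota phi.[t]^-1 * s'.[iota t]).
    split; last rewrite -mulrA; rewrite ?mulrA -?iotaC -?mulrA -hornerM_iota //.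
      by rewrite (deg_mulr sep) horner_map -rmorphM mulVf // rmorph1.
    by rewrite (deg_mull sep) horner_map -rmorphM mulVf // rmorph1.
  apply: contrapT => H; apply: noex; exists (Units ut) => p p0 [c Hc]; apply: H.
  exists p => //; exists ((phi.[t] ^+ k) ^+ p * c).
  rewrite hornerM_iota // hornerC (Pk t (Units ut)) // -mulrA -uvalM.
  rewrite exprMn_comm; last exact: iotaC.
  by rewrite Hc !rmorphM !rmorphXn.
pose S p := [set t | (0 < p)%N /\ central (Q.[iota t] ^+ p)].
have [p [p0 Sp]] : exists p, (0 < p)%N /\ infinite_set (S p).
  apply: contrapT => nop; apply: Func.
  have fin p : finite_set (S p).
    apply: contrapT => Sp; apply: nop; exists p; split=> //.
    by rewrite lt0n; apply/eqP => p0; apply: Sp;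
      rewrite p0 (_ : S 0%N = classical_sets.set0) //; apply/seteqP;
      split => t // [].
  pose C p := [set t | (map_poly iota phi).[iota t] = 0] `|` S p.
  have cov : [set: F] `<=` \bigcup_p C p.
    move=> t _; have [t0|/Qpc[p p0 Hp]] := eqVneq phi.[t] 0;
      last by exists p => //; right.
    by exists 0%N => //; left; rewrite /= horner_map t0 rmorph0.
  apply: sub_countable (subset_card_le cov) _.
  apply: bigcup_countable => // p _; apply: finite_set_countable.
  rewrite finite_setU; split=> //; apply: finite_central_roots => //.
  by rewrite map_poly_eq0 (deg_neq0 sep).
(* This commutator vanishes at every t in the infinite set [S p], hence identically. *)
have QpC y : Q ^+ p * y%:P = y%:P * Q ^+ p.
  apply/eqP; rewrite -subr_eq0; apply/eqP; apply: contrapT =>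
    /eqP/(finite_central_roots iotaC) fin.
  apply: Sp; apply: sub_finite_set fin => t [_ [c Hc]] /=.
  by rewrite hornerD hornerN !hornerM_iota // hornerC hornerX_iota // Hc iotaC
    subrr.
have [q Qq] : exists q, Q ^+ p = map_poly iota q.
  have cQ i : central (Q ^+ p)`_i.
    by apply: centerP => y; rewrite -coefMC QpC coefCM.
  exists (\poly_(i < size (Q ^+ p)) xget 0 [set k | (Q ^+ p)`_i = iota k]).
  apply/polyP => i; rewrite coef_map coef_poly;
    case: ltnP => [_|/leq_sizeP->] //=.
    by have [k0] := cQ i; case: xgetP => [k1 -> //|nok /nok].
  by rewrite rmorph0.
have QL m : L m -> L (act u Q m) by move=> Lm; rewrite actM actC; apply: PL;
  rewrite ?mem_head.
have QpL m : L m -> L (act u (Q ^+ p) m).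
  by elim: p {p0 Sp QpC Qq} => [|p IH] Lm; rewrite ?expr0 ?actC ?mul1r // exprS
    actM; apply/QL/IH.
(* [Q ^+ p] cannot act as zero, since it preserves [L]; nor injectively, since d^-1 m0 is in its
   kernel. *)
have [q0|qinj] := deg_place sep q.
  have [m Lm] := deg_nonempty sep; apply: (deg_nonzero sep).
  by have := QpL m Lm; rewrite Qq act_map_iota // q0 mulr0.
apply: m0_neq0; apply: (@uval_cancel _ d^-1%g); apply: qinj.
rewrite -act_map_iota // -Qq; apply: act_expr => //.
by rewrite actM actC mulrA uvalVr mul1r.
Qed.

End OpenWords.

(** * Subgroups of finite index *)

Section Subgroups.
Variable G : groupType.
Implicit Types (H K : set G) (x y : G).
Local Open Scope group_scope.

Lemma subgroup1 H : subgroup H -> H 1.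
Proof. by case; rewrite inE. Qed.

Lemma subgroupV H x : subgroup H -> H x -> H x^-1.
Proof. by case=> [H1 HB] Hx; have := HB 1 x; rewrite !inE mul1g; apply=> //;
  rewrite inE in H1. Qed.

Lemma subgroupM H x y : subgroup H -> H x -> H y -> H (x * y).
Proof.
move=> sH Hx Hy; have := (proj2 sH) x y^-1; rewrite !inE invgK; apply=> //.
exact: subgroupV.
Qed.

Lemma subgroupX H x k : subgroup H -> H x -> H (x ^+ k).
Proof.
by move=> sH Hx; elim: k => [|k IH]; [exact: subgroup1 | rewrite expgS;
  apply: subgroupM].
Qed.

(** With n cosets, two of the powers y^0, ..., y^n share a coset, so y^(j - i) is in [H] for some 0
    < j - i <= n, and j - i divides n!. *)
Lemma finite_index_exp H K : subgroup H -> subgroup K -> finite_index H K ->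
  exists2 k, (0 < k)%N & forall y, K y -> H (y ^+ k).
Proof.
move=> sH sK [_ /finite_setP[n Sn]]; exists n`!; first exact: fact_gt0.
move=> y Ky; pose coset i := [set y ^+ i * h | h in H].
have [i [j [ltij lejn eqij]]] :
    exists i j, [/\ (i < j)%N, (j <= n)%N & coset i = coset j].
  apply: contrapT => noij.
  have inj : {in `I_n.+1 &, injective coset}.
    move=> i j; rewrite !inE /= !ltnS => lein lejn eqij.
    by case: (ltngtP i j) => // lt; case: noij; [exists i, j | exists j, i].
  have sub : coset @` `I_n.+1 `<=` [set [set x * h | h in H] | x in K].
    by move=> _ [i _ <-]; exists (y ^+ i) => //; apply: subgroupX.
  have := subset_card_le sub; rewrite (card_le_eqr Sn).
  by rewrite (card_le_eql (inj_card_eq inj)) card_le_II ltnn.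
have : coset j (y ^+ j) by exists 1; rewrite ?mulg1 //; apply: subgroup1.
rewrite -eqij => -[h Hh yij].
have Hji : H (y ^+ (j - i)).
  by rewrite (_ : y ^+ (j - i) = h) //; apply: (mulgI (y ^+ i));
    rewrite -expgnDr subnKC // ltnW.
have /dvdnP[m ->] : (j - i %| n`!)%N.
  by rewrite dvdn_fact // subn_gt0 ltij (leq_trans (leq_subr i j)).
by rewrite mulnC expgnA; apply: subgroupX.
Qed.

End Subgroups.

(** * Words with coefficients and substitution of elements of [N] *)

Section Letters.
Variables (F : Type) (A : pzRingType) (iota : F -> A) (I : choiceType).
Notation G := (units A).
Notation letter := (I * bool)%type.

Definition act_letter (c : I -> G) (l : letter) : G :=
  if l.2 then (c l.1)^-1%g else c l.1.

Definition word_val (c : I -> G) (s : seq (letter * G)) : G :=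
  (\prod_(t <- s) (act_letter c t.1 * t.2))%g.

(** A letter cancels against its inverse across a central coefficient; this is what is excluded. *)
Definition reduced_pair (t t' : letter * G) : bool :=
  `[< t'.1 = linv t.1 -> ~ (exists k, uval t.2 = iota k) >].

End Letters.
Arguments reduced_pair {F A} iota {I} t t'.

Section Substitution.
Variables (F : fieldType) (A : nzRingType) (iota : {rmorphism F -> A}).
Hypothesis iotaC : forall k a, iota k * a = a * iota k.
Notation G := (units A).
Notation central a := (exists k, a = iota k).
Notation open_word := (open_word iota).

Lemma open_pow f (b : G) k : open_word f -> ~ central (uval b) ->
  exists2 f', open_word f' & forall x, ((f x * b) ^+ k.+1 = f' x * b)%g.
Proof.
move=> of_ nb; elim: k => [|k [f' of' IH]]; first by exists f.
by exists (fun x => f x * b * f' x)%g => [|x];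
  [exact: open_mul | rewrite expgS IH !mulgA].
Qed.

(** The shape f(x) a^-1 persists down the chain. For y = f(x) a^-1, a normal step uses a^-1 (y^-1 a
    y) = f(x)^-1 a f(x) a^-1, and a step of finite index uses a power of y. *)
Lemma open_word_almost_subnormal (N : set G) (a : G) :
  almost_subnormal N -> N a -> ~ central (uval a) ->
  subgroup N /\ exists2 f, open_word f & forall x, N (f x * a^-1)%g.
Proof.
move=> [r [K [K0 <- sK step]]] Na na; split; first exact: sK.
have Ka j i : (i + j = r)%N -> K i a.
  elim: j i => [|j IH] i; first by rewrite addn0 => ->.
  move=> ijr; have Ka : K i.+1 a by apply: IH; rewrite addSnnS.
  have ltir : (i < r)%N by rewrite -ijr addnS ltnS leq_addr.
  by case: (step _ ltir) => [[sub _]|[sub _]]; apply: sub.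
suff H i : (i <= r)%N -> exists2 f, open_word f & forall x, K i (f x * a^-1)%g.
  exact: H.
elim: i => [_|i IH ltir]; first by exists id; [exact: open_id | rewrite K0].
have [f of_ Kf] := IH (ltnW ltir).
have Kia : K i a by apply: (Ka (r - i)%N); rewrite subnKC // ltnW.
have Ki1a : K i.+1 a by apply: (Ka (r - i.+1)%N); rewrite subnKC.
have sKi := sK _ (ltnW ltir); have sKi1 := sK _ ltir.
case: (step _ ltir) => [[_ nrm]|fi].
  exists (fun x => (f x)^-1 * a * f x)%g => [|x];
    first by apply: open_mul => //; apply: open_inv.
  have := nrm _ _ Ki1a (Kf x); rewrite conjgE => Hc.
  have := subgroupM sKi1 (subgroupV sKi1 Ki1a) Hc.
  by rewrite invgM invgK !mulgA mulVg mul1g.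
have [k k0 Hk] := finite_index_exp sKi1 sKi fi.
have [f' of' Hf'] := open_pow k.-1 of_ (noncentralV na).
by exists f' => // x; rewrite -Hf' prednK //; apply/Hk/Kf.
Qed.

Hypothesis generic : forall U : seq G,
  exists g, {in U, forall v, ~ central (uval (v^-1 * g)%g)}.

(** The elements are chosen one at a time; each new one avoids finitely many cosets of the central
    units, in two lists as it may stand on the left or on the right. *)
Lemma generic_family (T : eqType) (r : seq T) (Z : seq G) : uniq r ->
  exists g : T -> G, {in r &, forall i j, i != j ->
    {in Z, forall z, ~ central (uval ((g i)^-1 * z * g j)%g)}}.
Proof.
elim: r => [|t r IH] /=; first by exists (fun=> 1%g).
move=> /andP[tr /IH[g Hg]].
have [x Hx] := generic ([seq z^-1 * g i | z <- Z, i <- r] ++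
                        [seq z * g i | z <- Z, i <- r])%g.
exists (fun i => if i == t then x else g i) => i j.
rewrite !inE; have [->|_] := eqVneq i t; have [->|_] := eqVneq j t.
- by move=> _ _ /=; rewrite ?eqxx.
- rewrite orFb => _ jr _ z zZ c; have := Hx (z * g j)%g.
  rewrite mem_cat (allpairs_f (fun z i => z * g i)%g zZ jr) orbT => /(_ isT);
    apply.
  have := @centralV _ _ _ (x^-1 * z * g j)%g c.
  by rewrite !invgM invgK !mulgA.
- rewrite orFb => ir _ _ z zZ; have := Hx (z^-1 * g i)%g.
  rewrite mem_cat (allpairs_f (fun z i => z^-1 * g i)%g zZ ir).
  by move=> /(_ isT); rewrite invgM invgK.
by rewrite !orFb => ir jr; apply: Hg.
Qed.

Variable I : finType.
Local Notation letter := (I * bool)%type.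

Variables (N : set G) (a : G).
Hypotheses (asN : almost_subnormal N) (Na : N a) (na : ~ central (uval a)).

(** Each variable becomes a product of two elements f(.) a^-1 of [N], so that its two ends carry
    independent generic elements. The coefficient z between letters l and l' becomes L(linv l)^-1 z
    L(l'): noncentral by genericity if l' differs from linv l, and otherwise a conjugate of z. *)
Lemma generic_substitution (Z : seq G) :
  exists (L : letter -> G) (q : I -> G -> G),
  [/\ forall i, open_word (q i),
      forall i x, N (L (i, false) * q i x * (L (i, true))^-1)%g &
      forall l l', l != l' ->
        {in Z, forall z, ~ central (uval ((L l)^-1 * z * L l')%g)}].
Proof.
have [sN [f of_ Nf]] := open_word_almost_subnormal asN Na na.
(* The element a^-1 joins the two halves of q_i; the products with [a] absorb the factor [a] in L(i,
   true). *)
pose Z' := (a^-1 :: Z ++ [seq a^-1 * z | z <- Z] ++ [seq z * a | z <- Z]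
             ++ [seq a^-1 * z * a | z <- Z])%g.
have [g Hg] := generic_family Z' (enum_uniq {: letter}).
have {}Hg l l' z : l != l' -> z \in Z' ->
    ~ central (uval ((g l)^-1 * z * g l')%g).
  by move=> ll' zZ'; apply: Hg; rewrite ?mem_enum.
pose fg l x := ((g l)^-1 * f (g l * x * (g l)^-1) * g l)%g.
have ofg l : open_word (fg l) by apply: open_conj.
exists (fun l => if l.2 then a * g l else g l)%g.
exists (fun i x => fg (i, false) x *
  ((g (i, false))^-1 * a^-1 * g (i, true)) * fg (i, true) x)%g.
split.
- by move=> i; apply: open_mul => //; apply: Hg;
    rewrite ?mem_head // xpair_eqE andbF.
- move=> i x /=; rewrite /fg; set y := f _; set z := f _.
  rewrite (_ : (_ * _)%g = (y * a^-1) * (z * a^-1))%g;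
    first exact: subgroupM sN (Nf _) (Nf _).
  by rewrite invgM !mulgA mulgV mul1g !mulgK.
move=> [i b] [j c] ne z zZ.
have [] : [/\ z \in Z', a^-1 * z \in Z', z * a \in Z' & a^-1 * z * a \in Z']%g.
  split; rewrite inE !mem_cat ?zZ ?orbT //.
  - by rewrite (map_f (fun z => a^-1 * z)%g zZ) !orbT.
  - by rewrite (map_f (fun z => z * a)%g zZ) !orbT.
  - by rewrite (map_f (fun z => a^-1 * z * a)%g zZ) !orbT.
case: b c ne => [] [] ne z1 z2 z3 z4.
- by have := Hg _ _ _ ne z4; rewrite invgM !mulgA.
- by have := Hg _ _ _ ne z2; rewrite invgM !mulgA.
- by have := Hg _ _ _ ne z3; rewrite !mulgA.
- by have := Hg _ _ _ ne z1.
Qed.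

Lemma word_val_substitution (Z : seq G) L q (c : G -> I -> G)
    (t : letter * G) s :
  (forall x i, c x i = L (i, false) * q i x * (L (i, true))^-1)%g ->
  (forall i, open_word (q i)) ->
  (forall l l', l != l' ->
     {in Z, forall z, ~ central (uval ((L l)^-1 * z * L l')%g)}) ->
  {subset [seq t.2 | t <- t :: s] <= Z} ->
  path (reduced_pair iota) t s ->
  exists2 f, open_word f & forall x,
    word_val (c x) (t :: s) =
    (L t.1 * f x * ((L (linv (last t s).1))^-1 * (last t s).2))%g.
Proof.
move=> cE oq HL.
have step (l : letter) : exists2 f, open_word f & forall x,
    act_letter (c x) l = (L l * f x * (L (linv l))^-1)%g.
  case: l => i [].
    exists (fun x => (q i x)^-1)%g => [|x]; first exact/open_inv/oq.
    by rewrite /act_letter cE !invgM invgK mulgA.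
  by exists (q i) => // x; rewrite /act_letter cE.
elim: s t => [|t' s IH] t sZ /=.
  have [f of_ Hf] := step t.1; exists f => // x.
  by rewrite /word_val big_seq1 Hf mulgA.
move=> /andP[/asboolP red /IH[|f of_ Hf]].
  by move=> z zs; apply: sZ; rewrite map_cons inE zs orbT.
have [h oh Hh] := step t.1.
exists (fun x => h x * ((L (linv t.1))^-1 * t.2 * L t'.1) * f x)%g.
  apply: open_mul => //; have [eqt|net] := eqVneq (linv t.1) t'.1.
    by rewrite -eqt => /(centralJ iotaC); apply: red.
  by apply: HL => //; apply: sZ; rewrite mem_head.
by move=> x; rewrite /word_val big_cons -/(word_val _ _) Hf Hh !mulgA.
Qed.

Hypothesis centerP : forall a, (forall y, a * y = y * a) -> central a.
Hypothesis Func : ~ countable [set: F].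
Hypothesis deg : forall (b0 : G) B,
    {in b0 :: B, forall b, ~ central (uval b)} ->
  exists u s s' phi L, degeneration iota (b0 :: B) u s s' phi L.

(** Conjugation by [L t.1] turns the value into f(x) d, where d is the coefficient between the last
    letter and the first; it is noncentral because the word is cyclically reduced. *)
Lemma word_not_power_central (s : seq (letter * G)) : s != [::] ->
    cycle (reduced_pair iota) s ->
  exists2 c, (forall i, N (c i)) &
    forall p, (0 < p)%N -> ~ central (uval (word_val c s) ^+ p).
Proof.
case: s => // t s _; rewrite /cycle rcons_path => /andP[ps /asboolP red].
have [L [q [oq Nq HL]]] := generic_substitution [seq t.2 | t <- t :: s].
have [//|f of_ Hf] := word_val_substitution (fun x i => erefl _) oq HL _ ps.
have nd :
    ~ central (uval ((L (linv (last t s).1))^-1 * (last t s).2 * L t.1)%g).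
  have [eqt|net] := eqVneq (linv (last t s).1) t.1.
    by rewrite -eqt => /(centralJ iotaC); apply: red.
  by apply: HL => //; apply/mapP; exists (last t s) => //; apply: mem_last.
have [x Hx] := open_word_not_power_central iotaC centerP Func deg of_ nd.
exists (fun i => L (i, false) * q i x * (L (i, true))^-1)%g => // p p0 [k Hk].
apply: (Hx p p0); exists k; rewrite -uvalX.
set d := (_ * L t.1)%g; set w := word_val _ _ in Hk.
have wE : (f x * d = (L t.1)^-1 * w * L t.1)%g.
  by rewrite /w Hf /d !mulgA mulVg mul1g.
have wpE : ((f x * d) ^+ p = (L t.1)^-1 * w ^+ p * L t.1)%g.
  rewrite wE; elim: p {p0 Hk} => [|p IH]; first by rewrite !expg0 mulg1 mulVg.
  by rewrite expgS IH (expgS w) !mulgA mulgK.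
by rewrite wpE !uvalM uvalX Hk -iotaC -mulrA uvalVl mulr1.
Qed.

End Substitution.

(** * Cyclic reduction, uniformly in all interpretations *)

Lemma not_path (T : Type) (e : rel T) x p : ~~ path e x p ->
  exists p1 y z p2, x :: p = p1 ++ [:: y, z & p2] /\ ~~ e y z.
Proof.
elim: p x => //= y p IH x; rewrite negb_and =>
  /orP[exy|/IH[p1 [z [z' [p2 [-> ne]]]]]].
  by exists [::], x, y, p.
by exists (x :: p1), z, z', p2.
Qed.

Lemma not_cycle (T : Type) (e : rel T) s : ~~ cycle e s ->
  (exists s1 s2 y z r, [/\ s = s1 ++ s2, s2 ++ s1 = [:: y, z & r] & ~~ e y z])
  \/ exists2 y, s = [:: y] & ~~ e y y.
Proof.
case: s => // x p; rewrite /cycle => np.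
have [p1 [y [z [p2 [sE ne]]]]] := not_path np.
case/lastP: p2 sE => [|p2 x']; last first.
  rewrite -!rcons_cons -rcons_cat => /rcons_inj[sE _]; left.
  by exists p1, [:: y, z & p2], y, z, (p2 ++ p1); rewrite sE.
have -> : p1 ++ [:: y; z] = rcons (rcons p1 y) z by rewrite -!cats1 -catA.
rewrite -rcons_cons => /rcons_inj[sE xz]; subst z.
case: p1 sE => [[xy ->]|x1 p1 [xx1 ->]]; first by right; exists x;
  rewrite // {1}xy.
by left; exists (x :: p1), [:: y], y, x, p1; rewrite cats1.
Qed.

Section Interpretations.
Variables (F : fieldType) (A : pzRingType) (iota : {rmorphism F -> A}).
Hypothesis iotaC : forall k a, iota k * a = a * iota k.
Variable I : choiceType.
Notation G := (units A).
Notation letter := (I * bool)%type.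
Notation word := (seq (letter * G)).

(* Common to the evaluation of words in A_F[X, X^-1] and at elements of A^*.  *)
Record interpretation := Interpretation {
  icod :> pzRingType;
  icoef : {rmorphism A -> icod};
  ilet : letter -> icod;
  iletV : forall l, ilet l * ilet (linv l) = 1;
  iletC : forall k l, icoef (iota k) * ilet l = ilet l * icoef (iota k) }.

Implicit Type J : interpretation.

Definition ival J (s : word) : J :=
  \prod_(t <- s) (ilet J t.1 * icoef J (uval t.2)).

Definition power_central J (v : J) : Prop :=
  exists2 p, (0 < p)%N & exists k, v ^+ p = icoef J (iota k).

(** These two conditions suffice to pass from (u v)^p = k to (v u)^p = v (u v)^p v' = k. *)
Definition regular J (v : J) : Prop :=
  (exists v', v * v' = 1) /\
  forall k, icoef J (iota k) * v = v * icoef J (iota k).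

Lemma regular_coef J (a : G) : regular (icoef J (uval a)).
Proof.
split; first by exists (icoef J (uval a^-1%g)); rewrite -rmorphM uvalVr rmorph1.
by move=> k; rewrite -!rmorphM iotaC.
Qed.

Lemma regularM J (u v : J) : regular u -> regular v -> regular (u * v).
Proof.
move=> [[u' uu'] uC] [[v' vv'] vC]; split.
  by exists (v' * u'); rewrite mulrA -(mulrA u) vv' mulr1.
by move=> k; rewrite mulrA uC -mulrA vC mulrA.
Qed.

Lemma regular_let J l : regular (ilet J l).
Proof.
by split; [exists (ilet J (linv l)); exact: iletV | move=> k; exact: iletC].
Qed.

Lemma regular_ival J s : regular (ival J s).
Proof.
rewrite /ival; elim: s => [|t s IH].
  by rewrite big_nil; split=> [|k]; [exists 1;
    rewrite mulr1 | rewrite mulr1 mul1r].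
rewrite big_cons; apply: regularM IH; apply: regularM; first exact: regular_let.
exact: regular_coef.
Qed.

Lemma power_central_comm J (u v : J) : regular v ->
  power_central (u * v) -> power_central (v * u).
Proof.
move=> [[v' vv'] vC] [p p0 [k Hk]]; exists p => //; exists k.
have comm j : (v * u) ^+ j * v = v * (u * v) ^+ j.
  elim: j => [|j IH]; first by rewrite !expr0 mulr1 mul1r.
  by rewrite exprS -mulrA IH exprS !mulrA.
by rewrite -[LHS]mulr1 -vv' mulrA comm Hk -vC -mulrA vv' mulr1.
Qed.

Lemma power_centralC J (u v : J) : regular u -> regular v ->
  power_central (u * v) <-> power_central (v * u).
Proof. by move=> ru rv; split; apply: power_central_comm. Qed.

Lemma ival_cat J s1 s2 : ival J (s1 ++ s2) = ival J s1 * ival J s2.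
Proof. exact: big_cat. Qed.

(** A pair violating reducedness is rotated to the front and cancelled across its central
    coefficient, which shortens the word by two letters. The result does not depend on [J], so facts
    found by evaluation can be carried to the formal monomial. *)
Lemma cyclic_reduction (a : G) (s : word) :
  (exists s', [/\ s' != [::], cycle (reduced_pair iota) s' &
     forall J, power_central (icoef J (uval a) * ival J s) <->
       power_central (ival J s')])
  \/ (exists b : G,
     forall J, power_central (icoef J (uval a) * ival J s) <->
       power_central (icoef J (uval b))).
Proof.
have [n le_sn] := ubnP (size s); elim: n s a le_sn => // n IH s a.
case/lastP: s => [_|s [l b]]; first by right; exists a => J;
  rewrite /ival big_nil mulr1.
rewrite size_rcons !ltnS => le_sn.
pose s1 := rcons s (l, (b * a)%g).
have s1P J : power_central (icoef J (uval a) * ival J (rcons s (l, b))) <->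
             power_central (ival J s1).
  rewrite power_centralC; [|exact: regular_coef|exact: regular_ival].
  by rewrite /s1 /ival -!cats1 !big_cat !big_seq1 -!mulrA -rmorphM.
have [cyc|] := boolP (cycle (reduced_pair iota) s1).
  by left; exists s1; split=> //; rewrite -size_eq0 size_rcons.
move=> /not_cycle[[s2 [s3 [y [z [r [sE rot /asboolPn ne]]]]]]|[y _ /asboolPn
  ne]]; last first.
  (* A letter is never its own inverse. *)
  by case: ne; case: y => [[i c] d] /=; rewrite /linv /= => -[]; case: c.
have [yz ybar] : z.1 = linv y.1 /\ exists k, uval y.2 = iota k.
  by split; apply: contrapT => H; apply: ne.
have szr : (size r < n)%N.
  have := congr1 size rot; rewrite size_cat addnC -size_cat -sE size_rcons =>
    -[szr].
  by apply: leq_trans le_sn; rewrite szr leqW.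
have rP J : power_central (ival J s1) <->
            power_central (icoef J (uval (y.2 * z.2)%g) * ival J r).
  rewrite sE ival_cat power_centralC;
    [|exact: regular_ival|exact: regular_ival].
  rewrite -ival_cat rot /ival !big_cons mulrA yz uvalM rmorphM.
  have [k ->] := ybar; rewrite -iletC -!mulrA (mulrA (ilet J _) (ilet J _))
    iletV mul1r.
  by rewrite !mulrA.
case: (IH r (y.2 * z.2)%g szr) => [[s' [ne0 cyc Hs']]|[c Hc]]; [left|right].
  by exists s'; split=> // J; rewrite s1P rP.
by exists c => J; rewrite s1P rP.
Qed.

Definition ipow J (i : I) (k : int) : J :=
  match k with
  | Posz k => ilet J (i, false) ^+ k
  | Negz k => ilet J (i, true) ^+ k.+1
  end.

Lemma word_of_factors (r : seq (G * I * int)) (b : G) :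
  exists (a : G) (s : word), forall J,
  (\prod_(t <- r) (icoef J (uval t.1.1) * ipow J t.1.2 t.2)) * icoef J (uval b)
  = icoef J (uval a) * ival J s.
Proof.
have pow l k (a : G) s : exists (a' : G) (s' : word), forall J,
    ilet J l ^+ k * (icoef J (uval a) * ival J s) =
    icoef J (uval a') * ival J s'.
  elim: k => [|k [a' [s' IH]]]; first by exists a, s => J; rewrite expr0 mul1r.
  exists 1%g, ((l, a') :: s') => J; rewrite exprS -mulrA IH uval1 rmorph1 mul1r.
  by rewrite /ival big_cons mulrA.
elim: r => [|[[c i] k] r [a [s IH]]]; first by exists b, [::] => J;
  rewrite /ival !big_nil mul1r mulr1.
pose l := (i, if k is Posz _ then false else true).
pose j := if k is Negz j then j.+1 else `|k|%N.
have [a' [s' Hs']] := pow l j a s.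
exists (c * a')%g, s' => J; rewrite big_cons -mulrA IH uvalM rmorphM -!mulrA
  -Hs'.
by congr (_ * (_ * _)); rewrite /l /j; case: (k).
Qed.

Definition eval_interpretation (c : I -> G) : interpretation.
Proof.
refine (@Interpretation A idfun (fun l => uval (act_letter c l)) _ _).
  by case=> i [] /=; rewrite /act_letter /=; [exact: uvalVl | exact: uvalVr].
by move=> k l; exact: iotaC.
Defined.

Lemma ival_eval c s : ival (eval_interpretation c) s = uval (word_val c s).
Proof.
rewrite /ival /word_val; elim: s => [|t s IH]; first by rewrite !big_nil.
by rewrite !big_cons IH.
Qed.

End Interpretations.

(** * Generic units and existence of degenerations *)

Section Existence.
Variables (F : fieldType) (A : nzRingType) (iota : {rmorphism F -> A}).
Hypothesis iotaC : forall k a, iota k * a = a * iota k.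
Notation G := (units A).
Notation central a := (exists k, a = iota k).
Hypothesis centerP : forall a, (forall y, a * y = y * a) -> central a.
Hypothesis Finf : infinite_set [set: F].

Lemma central_factor (r : {poly F}) c : (map_poly iota r).[c] = 0 ->
  exists2 Q, map_poly iota r = Q * ('X - c%:P) &
    map_poly iota r = ('X - c%:P) * Q.
Proof.
move=> /eqP/factor_theorem[Q rQ]; exists Q => //.
apply: (monic_rreg (monicXsubC c)).
by rewrite /= -mulrA -rQ -(map_iota_comm iotaC).
Qed.

(** The unit is t - c with r(t) nonzero, inverted by means of the cofactor of X - c in r. For each v
    some commutator of v^-1 (X - c) with a constant is a nonzero polynomial, as otherwise v^-1 and
    then c would be central; so only finitely many t are bad. *)
Lemma generic_unit c (r : {poly F}) : ~ central c -> r != 0 ->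
  (map_poly iota r).[c] = 0 ->
  forall U : seq G, exists g, {in U, forall v, ~ central (uval (v^-1 * g)%g)}.
Proof.
move=> nc r0 rc U.
have /choice[P HP] : forall v : G, exists P : {poly A}, P != 0 /\ forall t,
    P.[iota t] <> 0 -> ~ central (uval v^-1%g * (iota t - c)).
  move=> v; pose Q := (uval v^-1%g)%:P * ('X - c%:P).
  have [y Qy] : exists y, Q * y%:P - y%:P * Q != 0.
    apply: contrapT => noy; apply: nc; apply: centerP => y.
    have Qy z : Q * z%:P = z%:P * Q.
      by apply/eqP; rewrite -subr_eq0; apply: contrapT => Qz; apply: noy;
        exists z; apply/negP.
    have vC z : uval v^-1%g * z = z * uval v^-1%g.
      have /polyP/(_ 1%N) := Qy z.
      by rewrite coefMC !coefCM !coefB !coefX !coefC !subr0 !mulr1.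
    have /polyP/(_ 0%N) := Qy y.
    rewrite coefMC !coefCM !coefB !coefX !coefC !sub0r !mulrN !mulNr =>
      /oppr_inj.
    rewrite mulrA -vC -!mulrA => vcy.
    by rewrite -[LHS]mul1r -[RHS]mul1r -(uvalVr v) -!mulrA vcy.
  exists (Q * y%:P - y%:P * Q); split=> // t Pt [k Hk]; apply: Pt.
  rewrite hornerD hornerN !hornerM_iota // !hornerC hornerXsubC Hk iotaC.
  exact: subrr.
have [|t Ht] :=
    @central_nonroot _ _ iota iotaC Finf (map_poly iota r :: map P U).
  move=> Q; rewrite inE => /predU1P[->|/mapP[v _ ->]]; last by case: (HP v).
  by rewrite map_poly_eq0.
have [Q rQ rQ'] := central_factor rc.
have rt : r.[t] != 0.
  have := Ht _ (mem_head _ _); rewrite horner_map => H.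
  by apply/eqP => rt; apply: H; rewrite rt rmorph0.
have ut : is_unit (iota t - c).
  apply/asboolP; exists (Q.[iota t] * iota r.[t]^-1); split.
    rewrite mulrA -(hornerXsubC c) -hornerM_iota // -rQ' horner_map -rmorphM.
    by rewrite mulfV // rmorph1.
  rewrite -mulrA iotaC mulrA -(hornerXsubC c) -hornerM_iota // -rQ horner_map.
  by rewrite -rmorphM mulfV // rmorph1.
exists (Units ut) => v vU; rewrite uvalM; apply: (proj2 (HP v)).
by apply: Ht; rewrite inE (map_f P vU) orbT.
Qed.

(** * Degeneration from a rank-one idempotent *)

Section Idempotent.
Variable e : A.
Hypotheses (ee : e * e = e)
  (corner_inv : forall x, e * x * e != 0 -> exists y, y * (e * x * e) = e)
  (corner_faithful : forall c, c != 0 -> exists r, e * r * c != 0)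
  (noncentral_move : forall b, ~ central b ->
     exists p, [/\ e * p = e, p * e = p & b * p != p * b * p]).

(** The relations e p = e and p e = p are preserved on the line through p0 and p1, and each
    polynomial condition [R c] is nonzero at t = 0 or at t = 1. *)
Lemma common_moved (B : seq A) : {in B, forall b, ~ central b} ->
  exists p, [/\ e * p = e, p * e = p & {in B, forall b, b * p != p * b * p}].
Proof.
elim: B => [|b B IH] nB; first by exists e.
have [|p0 [ep0 pe0 Hp0]] := IH; first by move=> c cB; apply: nB;
  rewrite inE cB orbT.
have [p1 [ep1 pe1 Hp1]] := noncentral_move (nB _ (mem_head _ _)).
pose P := p0%:P + (p1 - p0)%:P * 'X.
pose R c := c%:P * P - P * c%:P * P.
have PE t : P.[iota t] = p0 + iota t * (p1 - p0).
  by rewrite /P hornerD hornerC hornerMX hornerC iotaC.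
have RE c t : (R c).[iota t] = c * P.[iota t] - P.[iota t] * c * P.[iota t].
  by rewrite /R hornerD hornerN !hornerM_iota // !hornerC.
have [|t Ht] := @central_nonroot _ _ iota iotaC Finf (map R (b :: B)).
  move=> _ /mapP[c cB ->]; apply/eqP => Rc0.
  move: cB; rewrite inE => /predU1P[cb|cB].
    have := RE c 1; rewrite Rc0 horner0 PE rmorph1 mul1r (addrC p0) subrK =>
      /esym/eqP.
    by rewrite subr_eq0 cb (negPf Hp1).
  have := RE c 0; rewrite Rc0 horner0 PE rmorph0 mul0r addr0 => /esym/eqP.
  by rewrite subr_eq0 (negPf (Hp0 _ cB)).
exists P.[iota t]; split=> [||c cB]; last first.
  by rewrite -subr_eq0 -RE; apply/eqP/Ht/map_f.
- by rewrite PE mulrDl -mulrA mulrBl pe0 pe1.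
- by rewrite PE mulrDr mulrA -iotaC -mulrA mulrBr ep0 ep1 subrr mulr0 addr0.
Qed.

(** No b in the list preserves the image of [p], so [r] can be chosen with e r (1 - p) b p nonzero.
    Then nu = p r (1 - p) has square zero while nu b nu does not vanish. At u = 0 the curves X + nu
    and X - nu act as nu and - nu, and their product is X^2. *)
Lemma degeneration_idempotent (b0 : G) (B : seq G) :
  {in b0 :: B, forall b, ~ central (uval b)} ->
  exists u s s' phi L, degeneration iota (b0 :: B) u s s' phi L.
Proof.
move=> nB; have [|p [ep pe Hp]] := @common_moved (map (@uval A) (b0 :: B)).
  by move=> _ /mapP[b bB ->]; apply: nB.
have pp : p * p = p by rewrite -{1}pe -mulrA ep pe.
pose C (b : G) := uval b * p - p * uval b * p.
have C0 b : b \in b0 :: B -> C b != 0.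
  by move=> bB; rewrite subr_eq0; apply/Hp/map_f.
have [|b bB|r Hr] := @common_nonzero _ _ iota iotaC Finf _ (b0 :: B)
    (fun b x => e * x * C b).
- by move=> b k x y /=; rewrite (mulrDr e) mulrDl (mulrA e (iota k)) -iotaC
    -!mulrA.
- by have [x Hx] := corner_faithful (C0 _ bB); exists x; apply/eqP.
pose nu := p * r * (1 - p).
have nunu : nu * nu = 0.
  by rewrite /nu -!mulrA (mulrA (1 - p)) mulrBl mul1r pp subrr mul0r !mulr0.
(* The corner element e r C(b) e has a left inverse, so it can be cancelled from nu b nu y = 0. *)
have nuC b y : b \in b0 :: B -> nu * y <> 0 -> nu * (uval b * (nu * y)) <> 0.
  move=> bB nuy; apply: contra_not nuy => H.
  have eC : e * r * C b * (r * (1 - p) * y) = 0.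
    have := congr1 (fun x => e * x) H; rewrite mulr0 => <-.
    rewrite /nu /C !mulrA ep; congr (_ * _ * _ * _).
    rewrite -!mulrA; congr (_ * (_ * _)).
    by rewrite mulrBl mul1r !mulrA.
  have Ce : C b = C b * e by rewrite /C mulrBl -!mulrA pe.
  have erC0 : e * (r * C b) * e != 0 by rewrite -!mulrA -Ce mulrA; apply/eqP/Hr.
  have [z zE] := corner_inv erC0.
  have : e * (r * (1 - p) * y) = 0.
    move: (C b) Ce zE eC {erC0} => c Ce zE eC.
    by rewrite -[RHS](mulr0 z) -eC -{1}zE [in RHS]Ce !mulrA.
  by rewrite /nu -pe -!mulrA => ->; rewrite mulr0.
have nu0 : nu <> 0.
  move=> nu0; have := Hr _ (mem_head _ _); apply.
  rewrite -ep /C -!mulrA.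
  have -> : p * (r * (uval b0 * p - p * (uval b0 * p))) = nu * (uval b0 * p).
    by rewrite /nu -!mulrA mulrBl mul1r.
  by rewrite nu0 mul0r mulr0.
have actp m : act 0 ('X + nu%:P) m = nu * m.
  by rewrite /act mulrDl hornerD -/(act 0 _ m) actX -/(act 0 _ m) actC mulr0
    add0r.
have actn m : act 0 ('X - nu%:P) m = - (nu * m).
  by rewrite actBl actX actC mulr0 sub0r.
exists 0, ('X + nu%:P), ('X - nu%:P), ('X ^+ 2).
exists (fun m => m <> 0 /\ exists y, m = nu * y).
have Xnu : 'X * nu%:P = nu%:P * 'X by rewrite commr_polyX.
split.
- by rewrite expf_neq0 // polyX_eq0.
- by rewrite map_polyXn mulrDl !mulrBr -Xnu subrKA -polyCM nunu subr0.
- by rewrite map_polyXn mulrBl !mulrDr -Xnu addrKA -polyCM nunu subr0.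
- move=> q; rewrite -(rmorph0 iota) horner_map.
  have [->|q0] := eqVneq q.[0] 0; first by left; rewrite rmorph0.
  right=> m; rewrite -(iotaC q.[0]).
  by rewrite rmorph0; apply: iota_cancel.
- by exists nu; split=> //; exists 1; rewrite mulr1.
- by case.
- move=> b bB m [m0 [y my]]; rewrite actp; split; last by eexists.
  by rewrite my; apply: (nuC b y bB); rewrite -my.
- move=> b bB m [m0 [y my]]; rewrite actn; split;
    last by exists (- (uval b * m)); rewrite mulrN.
  by apply/eqP; rewrite oppr_eq0 my; apply/eqP/(nuC b y bB); rewrite -my.
- by exists nu => //; rewrite actp.
- by exists nu => //; rewrite actn nunu oppr0.
Qed.

End Idempotent.

(** * Degeneration in an algebraic division algebra *)

Section Division.
Hypothesis divA : forall x : A, x != 0 -> exists y, x * y = 1 /\ y * x = 1.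
Hypothesis algA : forall x : A, exists2 r : {poly F},
  r != 0 & (map_poly iota r).[x] = 0.

Lemma div_eq0 (x y : A) : x * y = 0 -> x != 0 -> y = 0.
Proof.
by move=> xy /divA[z [_ zx]]; rewrite -[y]mul1r -zx -mulrA xy mulr0.
Qed.

(* The annihilator of the action at u is a two-sided ideal of A[X], hence     *)
(* generated by a polynomial with central coefficients.                       *)
Lemma annihilating_polynomial u P : P != 0 -> (forall m, act u P m = 0) ->
  exists q : {poly F}, [/\ q != 0, (size q <= size P)%N &
    (map_poly iota q).[u] = 0].
Proof.
move=> P0 PA; have [n le_n] := ubnP (size P).
elim: n P P0 PA le_n => // n IH P P0 PA; rewrite ltnS => le_n.
have lP0 : lead_coef P != 0 by rewrite lead_coef_eq0.
have [z [zl lz]] := divA lP0.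
have [M [szM MA M1]] : exists M : {poly A}, [/\ (size M <= size P)%N,
    forall m, act u M m = 0 & M`_(size P).-1 = 1].
  exists (z%:P * P); split=> [|m|]; last by rewrite coefCM.
    by apply/leq_sizeP => i /leq_sizeP Pi; rewrite coefCM Pi ?mulr0.
  by rewrite actM PA act0.
have szP : (0 < size P)%N by rewrite size_poly_gt0.
have M0 : M != 0 by apply: contra_eq_neq M1 => ->;
  rewrite coef0 eq_sym oner_neq0.
have comm a : a%:P * M = M * a%:P \/ exists q : {poly F},
    [/\ q != 0, (size q <= size P)%N & (map_poly iota q).[u] = 0].
  have [/eqP|nc] := eqVneq (a%:P * M - M * a%:P) 0;
    first by rewrite subr_eq0 => /eqP; left.
  right; have szc : (size (a%:P * M - M * a%:P)%R < size P)%N.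
    rewrite -(prednK szP) ltnS; apply/leq_sizeP => i;
      rewrite coefB coefCM coefMC leq_eqVlt.
    move=> /orP[/eqP<-|]; first by rewrite M1 mulr1 mul1r subrr.
    by rewrite prednK // => szi; rewrite (elimT (leq_sizeP _ _) szM _ szi)
      mulr0 mul0r subrr.
  have [|q [q0 szq qu]] := IH _ nc _ (leq_trans szc le_n).
    by move=> m; rewrite actBl !actM !MA act0 subrr.
  by exists q; split=> //; apply: leq_trans szq (ltnW szc).
have [//|nq] := pselect (exists q : {poly F},
    [/\ q != 0, (size q <= size P)%N & (map_poly iota q).[u] = 0]).
have {}comm a : a%:P * M = M * a%:P by case: (comm a).
have cM i : central M`_i.
  by apply: centerP => y; rewrite -coefMC -comm coefCM.
pose q := \poly_(i < size M) xget 0 [set k | M`_i = iota k].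
have Mq : M = map_poly iota q.
  apply/polyP => i; rewrite coef_map coef_poly;
    case: ltnP => [_|/leq_sizeP->] //=.
    by have [k0] := cM i; case: xgetP => [k1 -> //|nok /nok].
  by rewrite rmorph0.
exists q; split.
- by apply: contraNneq M0 => q0; rewrite Mq q0 rmorph0.
- exact: leq_trans (size_poly _ _) szM.
- by have := MA 1; rewrite Mq act_map_iota // mul1r.
Qed.

Lemma minimal_polynomial u : exists f : {poly F}, [/\ f != 0,
  (map_poly iota f).[u] = 0 &
  forall q, q != 0 -> (map_poly iota q).[u] = 0 -> (size f <= size q)%N].
Proof.
have exP : exists n, `[< exists f : {poly F}, [/\ f != 0,
  (map_poly iota f).[u] = 0 & size f = n] >].
  by have [f f0 fu] := algA u; exists (size f); apply/asboolP; exists f.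
case: (ex_minnP exP) => n /asboolP[g [g0 gu <-]] min; exists g;
  split=> // q q0 qu.
by apply: min; apply/asboolP; exists q.
Qed.

(** With f = g (X - u), the curve S a = g a (X - u) is (X - u)^-1 a (X - u) multiplied by f. At [u]
    it sends m to T(a (m u - u m)), and T has values in the centralizer of [u] because (X - u) g = f
    acts as zero. For m in that centralizer, b m goes to T(a (b u - u b)) m, so [L] is its nonzero
    part, and 1 is in the kernel. *)
Lemma degeneration_division (b0 : G) (B' : seq G) :
  {in b0 :: B', forall b, ~ central (uval b)} ->
  exists u s s' phi L, degeneration iota (b0 :: B') u s s' phi L.
Proof.
set B := b0 :: B' => nB.
have [b k x y|b bB|u Hu] := @common_nonzero _ _ iota iotaC Finf _ B
    (fun b x => uval b * x - x * uval b).
- by rewrite mulrDr mulrDl opprD addrACA mulrBr !mulrA (iotaC k (uval b)).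
- apply: contrapT => nox; apply: (nB _ bB); apply: centerP => x.
  by apply/eqP; rewrite -subr_eq0; apply: contrapT => xx; apply: nox; exists x;
    apply/eqP/negP.
have [f [f0 fu fmin]] := minimal_polynomial u.
have [g fg fg'] := central_factor fu.
pose T m := act u g m.
have mf0 : map_poly iota f != 0 by rewrite map_poly_eq0.
have g0 : g != 0 by apply: contraNneq mf0 => g0; rewrite fg g0 mul0r.
(* Otherwise g would yield a central polynomial of smaller degree than f vanishing at [u]. *)
have [m1 Tm1] : exists m, T m <> 0.
  apply: contrapT => noT; have [|q [q0 szq qu]] :=
    annihilating_polynomial (u := u) g0.
    by move=> m; apply: contrapT => Tm; apply: noT; exists m.
  have := leq_trans (fmin _ q0 qu) szq; rewrite -(size_map_poly iota f) fg.
  by rewrite size_Mmonic ?monicXsubC // size_XsubC addn2 ltnn.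
have actXsub m : act u ('X - u%:P) m = m * u - u * m by rewrite actBl actX actC.
have Tu m : T m * u = u * T m.
  by apply/eqP; rewrite -subr_eq0 -actXsub -actM -fg' act_map_iota // fu mulr0.
have Tl k m : T (iota k * m) = iota k * T m by rewrite iotaC /T actMr // iotaC.
have [c cE] : exists c : G -> A, forall b, c b = uval b * u - u * uval b by
  eexists.
have c0 b : b \in B -> c b != 0 by move=> bB; rewrite cE; apply/eqP/Hu.
have [b k x y|b bB|d Hd] := @common_nonzero _ _ iota iotaC Finf _ B
    (fun b x => T (x * c b)).
- by rewrite mulrDl -mulrA {1}/T actD -/(T _) -/(T (iota k * _)) Tl.
- by have [z [_ zc]] := divA (c0 _ bB); exists (m1 * z);
    rewrite -mulrA zc mulr1.
have d0 : d != 0.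
  by apply: contraPneq (Hd _ (mem_head _ _)) => ->; rewrite mul0r /T act0;
    apply.
have [d' [dd' d'd]] := divA d0.
(* From r = (X - d^2) H, the elements y = (t - d^2) d^-1 and z = d H(t) are inverse to each other up
   to r(t). *)
have [r r0 reta] := algA (d * d).
have [H rH rH'] := central_factor reta.
have lH : lead_coef H = iota (lead_coef r).
  by rewrite -lead_coef_map rH lead_coef_Mmonic ?monicXsubC.
pose P1 b := (T (d' * c b))%:P * 'X - (T (d * c b))%:P.
pose P2 b := map_poly (fun x => T (d * x * c b)) H.
have P2E b t : (P2 b).[iota t] = T (d * H.[iota t] * c b).
  have T2D x y : T (d * (x + y) * c b) = T (d * x * c b) + T (d * y * c b).
    by rewrite mulrDr mulrDl /T actD.
  have T20 : T (d * 0 * c b) = 0 by rewrite mulr0 mul0r /T act0.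
  rewrite (@horner_coef_wide _ (size H)) ?size_poly // horner_coef.
  rewrite (big_morph (fun x => T (d * x * c b)) T2D T20); apply: eq_bigr => j _.
  rewrite coef_map_id0 // -rmorphXn -(iotaC _ H`_j) -iotaC -Tl.
  by rewrite !mulrA iotaC.
have [|t Ht] := @central_nonroot _ _ iota iotaC Finf
    (map_poly iota r :: map P1 B ++ map P2 B).
  move=> Q; rewrite inE mem_cat => /or3P[/eqP->|/mapP[b bB ->]|/mapP[b bB ->]].
  - by rewrite map_poly_eq0.
  - apply: contraPneq (Hd _ bB) => /polyP/(_ 0%N).
    by rewrite coefB coefMX !coefC /= sub0r => /eqP;
      rewrite oppr_eq0 => /eqP-> /(_ erefl).
  apply: contraPneq (Hd _ bB) => /polyP/(_ (size H).-1).
  rewrite coef_map_id0; last by rewrite mulr0 mul0r /T act0.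
  rewrite -/(lead_coef H) lH coef0 -iotaC -mulrA Tl.
  have lr0 : lead_coef r != 0 by rewrite lead_coef_eq0.
  by move=> /(iota_cancel lr0)-> /(_ erefl).
have rt : r.[t] != 0.
  have := Ht _ (mem_head _ _); rewrite horner_map => rt.
  by apply/eqP => rt0; apply: rt; rewrite rt0 rmorph0.
(* The conditions on t make T (y c) and T (z c) nonzero, where z is           *)
(* proportional to y^-1: they hold at t = 0 for y = - d and at infinity for   *)
(* y^-1 ~ d / t, so they hold for all but finitely many t.                    *)
pose y := iota t * d' - d; pose z := d * H.[iota t].
have yE : y = (iota t - d * d) * d' by rewrite mulrBl -mulrA dd' mulr1.
have yz : y * z = iota r.[t].
  rewrite yE /z -mulrA (mulrA d') d'd mul1r -hornerXsubC -hornerM_iota // -rH'.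
  by rewrite horner_map.
have zy : z * y = iota r.[t].
  rewrite yE /z -mulrA (mulrA H.[_]) -hornerXsubC -hornerM_iota // -rH.
  by rewrite horner_map iotaC mulrA dd' mul1r.
have Ty b : b \in B -> T (y * c b) <> 0.
  move=> bB; have := Ht (P1 b); rewrite inE mem_cat (map_f P1 bB) orbT =>
    /(_ isT).
  rewrite /P1 hornerD hornerN hornerMX !hornerC -iotaC -Tl mulrA.
  by rewrite /T -mulN1r -(rmorph1 iota) -rmorphN -/(T _) -/(T (d * _)) -Tl
    -actD rmorphN rmorph1 mulN1r -mulNr -mulrDl.
have Tz b : b \in B -> T (z * c b) <> 0.
  move=> bB; rewrite -P2E; apply: Ht.
  by rewrite inE mem_cat (map_f P2 bB) !orbT.
pose S a := g * a%:P * ('X - u%:P).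
have actS a m : act u (S a) m = T (a * (m * u - u * m)).
  by rewrite !actM actC actXsub.
have SS a b : a * b = iota r.[t] ->
    S a * S b = map_poly iota (r.[t]%:P * f ^+ 2).
  move=> ab; transitivity (g * a%:P * map_poly iota f * b%:P * ('X - u%:P)).
    by rewrite fg' /S !mulrA.
  rewrite -(mulrA _ (map_poly iota f)) (map_iota_comm iotaC) mulrA -(mulrA g)
    -polyCM ab.
  rewrite -map_polyC -(map_iota_comm iotaC) -!mulrA (mulrA g).
  rewrite -(map_iota_comm iotaC) -mulrA -fg rmorphM rmorphXn /= expr2 !mulrA.
  by congr (_ * _); apply: map_iota_comm.
have nz (x m : A) : x <> 0 -> m <> 0 -> x * m <> 0.
  by move=> /eqP x0 m0 xm; apply: m0; apply: div_eq0 xm x0.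
exists u, (S y), (S z), (r.[t]%:P * f ^+ 2), (fun m => m <> 0 /\ m * u = u * m).
have stable a b m : b \in B -> T (a * c b) <> 0 -> m <> 0 /\ m * u = u * m ->
    act u (S a) (uval b * m) <> 0 /\
    act u (S a) (uval b * m) * u = u * act u (S a) (uval b * m).
  move=> bB Tab [m0 mu]; rewrite actS; split; last exact: Tu.
  rewrite (_ : a * _ = a * c b * m); first by rewrite /T actMr //; apply: nz.
  by rewrite -(mulrA a (c b)) cE mulrBl -!mulrA mu.
split.
- by rewrite mulf_neq0 ?polyC_eq0 ?expf_neq0.
- exact: SS.
- exact: SS.
- move=> q; have [->|/eqP q0] := eqVneq (map_poly iota q).[u] 0;
    [by left | right => m mq].
  by have [//|m0] := eqVneq m 0; case: q0; apply: div_eq0 mq m0.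
- by exists 1; rewrite mulr1 mul1r; split=> //; apply/eqP/oner_neq0.
- by case.
- by move=> b bB m; apply: stable (Ty _ bB).
- by move=> b bB m; apply: stable (Tz _ bB).
- by exists 1; [exact/eqP/oner_neq0 | rewrite actS mulr1 mul1r subrr mulr0 /T
    act0].
- by exists 1; [exact/eqP/oner_neq0 | rewrite actS mulr1 mul1r subrr mulr0 /T
    act0].
Qed.

End Division.
End Existence.

(** * Matrix algebras over a division ring *)

Section MatrixAlgebra.
Variables (F : fieldType) (D : unitAlgType F).
Notation iota := (@scalar_in F D _).
Hypothesis divD : division_ring D.
Hypothesis centerD : ring_center D = [set k%:A | k in [set: F]].

Lemma scalar_inC n k (M : 'M[D]_n) : iota k * M = M * iota k.
Proof.
apply/matrixP => i j; rewrite -[_ * M]/(_ *m _) mul_scalar_mx !mxE (bigD1 j)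
  //=.
rewrite big1 ?addr0 => [|l lj]; last by rewrite mxE (negPf lj) mulr0.
by rewrite mxE eqxx mulr1n mulr_algl mulr_algr.
Qed.

Lemma central_scalar (x : D) :
  (forall y, x * y = y * x) -> exists k : F, x = k%:A.
Proof.
by move=> xC; have : ring_center D x by []; rewrite centerD => -[k _ <-];
  exists k.
Qed.

Section Size2.
Variable n : nat.
Notation A := 'M[D]_n.+2.
Let e : A := delta_mx 0 0.

Lemma mulmx_delta0 (M : A) i j : (M * e) i j = M i 0 *+ (j == 0).
Proof.
rewrite mxE (bigD1 0) //= big1 ?addr0 => [|k k0]; last first.
  by rewrite mxE (negPf k0) mulr0.
by rewrite mxE eqxx /=; case: (j == 0); rewrite ?mulr1 ?mulr0.
Qed.

Lemma mul_delta0mx (M : A) i j : (e * M) i j = M 0 j *+ (i == 0).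
Proof.
rewrite mxE (bigD1 0) //= big1 ?addr0 => [|k k0]; last first.
  by rewrite mxE (negPf k0) andbF mul0r.
by rewrite mxE eqxx andbT; case: (i == 0); rewrite ?mul1r ?mul0r.
Qed.

Lemma delta0_idem : e * e = e.
Proof.
apply/matrixP => i j; rewrite mulmx_delta0 !mxE eqxx andbT.
by case: (i == 0); case: (j == 0).
Qed.

Lemma delta0_corner (M : A) : e * M * e != 0 -> exists y, y * (e * M * e) = e.
Proof.
move=> M0; have m0 : M 0 0 != 0.
  apply: contraNneq M0 => M00; apply/eqP/matrixP => i j.
  by rewrite mulmx_delta0 mul_delta0mx M00 mul0rn mul0rn mxE.
exists ((M 0 0)^-1%:M); apply/matrixP => i j.
rewrite -[_ * _]/(_ *m _) mul_scalar_mx mxE mulmx_delta0 mul_delta0mx !mxE.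
by case: (i == 0); case: (j == 0); rewrite /= ?mulr0 // mulVr // divD.
Qed.

Lemma delta0_faithful (M : A) : M != 0 -> exists r, e * r * M != 0.
Proof.
move=> M0; have [i [j Mij]] : exists i j, M i j != 0.
  apply: contrapT => H; move/eqP: M0; apply; apply/matrixP => i j; rewrite mxE.
  by apply: contrapT => /eqP Mij; apply: H; exists i, j.
exists (delta_mx 0 i); apply: contraNneq Mij => /matrixP/(_ 0 j).
rewrite -mulrA mul_delta0mx eqxx mulr1n mxE (bigD1 i) //= big1 ?addr0.
  by rewrite !mxE !eqxx mul1r => ->.
by move=> k ki; rewrite mxE (negPf ki) mul0r.
Qed.

(** The matrix [p i d] projects onto the line spanned by the column e_0 + e_i d; a matrix that
    preserves all these lines is scalar, with an entry in the center of D. *)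
Lemma noncentral_moves (M : A) : infinite_set [set: F] ->
  ~ (exists k, M = iota k) ->
  exists p, [/\ e * p = e, p * e = p & M * p != p * M * p].
Proof.
move=> Finf nM; apply: contrapT => nop; apply: nM.
pose p i (d : D) : A := e + d *: delta_mx i 0.
have pE i d : i != 0 -> M * p i d = p i d * M * p i d.
  move=> i0; apply: contrapT => /eqP Mp; apply: nop; exists (p i d); split=> //.
    apply/matrixP => k l; rewrite mul_delta0mx !mxE (eq_sym 0 i) (negPf i0)
      mulr0 addr0.
    by case: (k == 0); case: (l == 0).
  by apply/matrixP => k l; rewrite mulmx_delta0 !mxE eqxx !andbT;
    case: (l == 0); rewrite ?andbT ?andbF ?mulr0 ?addr0 ?mulr0n.
have mulr_entry (X : A) i (d : D) k : (X * (d *: delta_mx i 0)) k 0 = X k i * d.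
  rewrite mxE (bigD1 i) //= big1 ?addr0 => [|l li];
    first by rewrite !mxE !eqxx mulr1.
  by rewrite !mxE (negPf li) mulr0 mulr0.
have mull_entry (X : A) i (d : D) k :
    ((d *: delta_mx i 0) * X) k 0 = (d * X 0 0) *+ (k == i).
  rewrite mxE (bigD1 0) //= big1 ?addr0 => [|l l0]; last first.
    by rewrite !mxE (negPf l0) andbF mulr0 mul0r.
  by rewrite !mxE eqxx andbT; case: (k == i); rewrite ?mulr1 ?mulr0 ?mul0r.
have entryD (X Y : A) i j : (X + Y) i j = X i j + Y i j by rewrite mxE.
have key i k d : i != 0 -> k != 0 ->
    M k 0 + M k i * d = (d * (M 0 0 + M 0 i * d)) *+ (k == i).
  move=> i0 k0; have := pE i d i0; rewrite -mulrA => /matrixP/(_ k 0).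
  have col l : (M * p i d) l 0 = M l 0 + M l i * d.
    by rewrite /p mulrDr entryD mulmx_delta0 eqxx mulr1n mulr_entry.
  rewrite col {1}/p mulrDl entryD mul_delta0mx (negPf k0) mulr0n add0r
    mull_entry.
  by rewrite col.
have Mk0 k : k != 0 -> M k 0 = 0.
  by move=> k0; have := key k k 0 k0 k0; rewrite mulr0 mul0r mul0rn addr0.
have {}key i k d : i != 0 -> k != 0 ->
    M k i * d = (d * (M 0 0 + M 0 i * d)) *+ (k == i).
  by move=> i0 k0; rewrite -key // Mk0 // add0r.
(* [key] is quadratic in d; comparing d = 1 with d = t forces M 0 i = 0. *)
have [t [t0 t1]] : exists t : F, t != 0 /\ t != 1.
  apply: contrapT => not; apply: Finf.
  apply: (sub_finite_set _ (finite_set2 0 1)) => t _.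
  by have [->|t0] := eqVneq t 0; [left|right; apply: contrapT => /eqP t1;
    apply: not; exists t].
have M0i i : i != 0 -> M 0 i = 0.
  move=> i0; have := key i i 1 i0 i0; rewrite eqxx !mulr1 mul1r mulr1n => Mii.
  have := key i i t%:A i0 i0; rewrite eqxx mulr1n Mii !mulr_algr mulr_algl.
  move=> /(scalerI t0)/addrI/eqP; rewrite -subr_eq0 -{1}[M 0 i]scale1r
    -scalerBl.
  by rewrite scaler_eq0 subr_eq0 eq_sym (negPf t1) => /eqP.
have Mii i d : i != 0 -> M i i * d = d * M 0 0.
  by move=> i0; rewrite key // eqxx (M0i i) // mul0r addr0.
have Mi i : i != 0 -> M i i = M 0 0 by move=> i0;
  rewrite -[LHS]mulr1 Mii // mul1r.
have [k Mk] : exists k : F, M 0 0 = k%:A.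
  by apply: central_scalar => d; rewrite -(Mii 1 d) // Mi.
exists k; apply/matrixP => i j; rewrite /scalar_in mxE -Mk.
have [->|ij] := eqVneq i j; first by rewrite mulr1n;
  have [->|/Mi] := eqVneq j 0.
rewrite mulr0n; have [i0|i0] := eqVneq i 0.
  by rewrite i0 M0i // -i0 eq_sym.
have [->|j0] := eqVneq j 0; first exact: Mk0.
by rewrite -[LHS]mulr1 key // (negPf ij).
Qed.

Lemma scalar_in_center2 (M : A) : infinite_set [set: F] ->
  (forall X, M * X = X * M) -> exists k, M = iota k.
Proof.
move=> Finf MC; apply: contrapT => /(noncentral_moves Finf)[p [ep pe]].
by rewrite -MC -mulrA -{2}pe -(mulrA p e) ep pe eqxx.
Qed.

End Size2.

Section Size1.
Notation A := 'M[D]_1.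

Lemma mx11_div (M : A) : M != 0 -> exists X, M * X = 1 /\ X * M = 1.
Proof.
move=> M0; have /divD m0 : M 0 0 != 0.
  by apply: contraNneq M0 => M00; rewrite [M]mx11_scalar M00 raddf0.
exists ((M 0 0)^-1%:M); rewrite {1 4}[M]mx11_scalar.
by split; rewrite -[_ * _]/(_ *m _) -scalar_mxM ?mulrV ?mulVr.
Qed.

Lemma scalar_in_center1 (M : A) :
  (forall X, M * X = X * M) -> exists k, M = iota k.
Proof.
move=> MC; have [y|k Mk] := @central_scalar (M 0 0).
  have := MC y%:M; rewrite {1 2}[M]mx11_scalar -[LHS]/(_ *m _) -[RHS]/(_ *m _).
  by rewrite -!scalar_mxM => /matrixP/(_ 0 0); rewrite !mxE !eqxx !mulr1n.
by exists k; rewrite [LHS]mx11_scalar Mk.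
Qed.

Lemma mx11_algebraic (M : A) : is_algebraic D ->
  exists2 r : {poly F}, r != 0 & (map_poly iota r).[M] = 0.
Proof.
move=> /(_ (M 0 0))[r r0 /rootP rM]; exists r => //.
have -> : map_poly (@scalar_in F D 1) r =
    map_poly (@scalar_mx D 1) (map_poly (in_alg D) r).
  by rewrite -map_poly_comp.
by rewrite [M in LHS]mx11_scalar horner_map /= rM raddf0.
Qed.

End Size1.
End MatrixAlgebra.

(** * Generalized monomials as words *)

Section GenericInterpretation.
Variables (F : fieldType) (D : unitAlgType F) (n m : nat).
Notation iota := (@scalar_in F D n).
Notation G := (units 'M[D]_n).

Lemma grpA_mul (u v : free_grp m) :
  grpA D n (u * v)%g = grpA D n u * grpA D n v.
Proof.
rewrite /grpA -(rmorphM (coprod_inr _ _)); congr coprod_inr.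
by rewrite -[RHS]/(galg_mul _ _) /galg_of galg_mulUU mulr1.
Qed.

Lemma grpA1 : grpA D n (1%g : free_grp m) = 1.
Proof. exact: (rmorph1 (coprod_inr _ _)). Qed.

Lemma grpA_scalarC (k : F) (u : free_grp m) :
  constA m (iota k) * grpA D n u = grpA D n u * constA m (iota k).
Proof.
rewrite /constA coprod_base /grpA -!(rmorphM (coprod_inr _ _));
  congr coprod_inr.
by rewrite -[LHS]/(galg_mul _ _) -[RHS]/(galg_mul _ _) !galg_mulUU mulg1 mul1g
  mulr1 mul1r.
Qed.

Definition gen_letter (l : 'I_m * bool) : genA D n m :=
  grpA D n (if l.2 then (fg_gen l.1)^-1 else fg_gen l.1)%g.

Lemma gen_letterV l : gen_letter l * gen_letter (linv l) = 1.
Proof.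
by case: l => i []; rewrite /gen_letter -grpA_mul ?mulVg ?mulgV grpA1.
Qed.

(** Here the letters stand for themselves in A_F[X,X^-1]: a power-central value is just what
    non-triviality forbids. *)
Definition gen_interpretation : interpretation iota 'I_m :=
  @Interpretation _ _ iota 'I_m (coprod iota (galg_scalar (free_grp m)))
    (coprod_inl _ _) gen_letter gen_letterV (fun k l => grpA_scalarC k _).

Lemma grpA_exp (u : free_grp m) k : grpA D n (u ^+ k)%g = grpA D n u ^+ k.
Proof. by elim: k => [|k IH]; rewrite ?grpA1 // expgS exprS grpA_mul IH. Qed.

Lemma gmon_eltE (w : gmon D n m) : gmon_elt w =
  (\prod_(t <- gfactors w) (icoef gen_interpretation (uval t.1.1) *
     ipow gen_interpretation t.1.2 t.2))
  * icoef gen_interpretation (uval (glast w)).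
Proof.
congr (_ * _); apply: eq_bigr => -[[a i] k] _; congr (_ * _).
by case: k => k; rewrite /= ?grpA_exp // -expVgn grpA_exp.
Qed.

Hypothesis iotaC : forall k a, iota k * a = a * iota k.

Lemma gmon_evalE (w : gmon D n m) (c : 'I_m -> G) :
  let J := eval_interpretation iotaC c in
  uval (gmon_eval w c) =
  (\prod_(t <- gfactors w) (icoef J (uval t.1.1) * ipow J t.1.2 t.2))
  * icoef J (uval (glast w)).
Proof.
move=> J; congr (_ * _); elim: (gfactors w) => [|[[a i] k] r IH];
  first by rewrite !big_nil.
rewrite !big_cons uvalM IH uvalM; congr (_ * _ * _).
by case: k => k; [exact: uvalX | rewrite -[RHS](uvalX (c i)^-1%g k.+1) expVgn].
Qed.

End GenericInterpretation.

(** * A noncentral element of [N] contradicts the identity *)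

Section Main.
Variables (F : fieldType) (D : unitAlgType F) (n : nat).
Notation A := 'M[D]_n.+1.
Notation iota := (@scalar_in F D n.+1).
Notation G := (units A).
Notation central a := (exists k, a = iota k).
Variables (N : set G) (a : G).
Hypotheses (Func : ~ countable [set: F])
  (centerP : forall x : A, (forall y, x * y = y * x) -> central x)
  (generic : forall U : seq G,
     exists g, {in U, forall v, ~ central (uval (v^-1 * g)%g)})
  (deg : forall (b0 : G) B, {in b0 :: B, forall b, ~ central (uval b)} ->
    exists u s s' phi L, degeneration iota (b0 :: B) u s s' phi L)
  (asN : almost_subnormal N) (Na : N a) (na : ~ central (uval a)).

Lemma no_nontrivial_GPCGI m (w : gmon D n.+1 m) : GPCGI N w ->
    nontrivial_gmon w -> False.
Proof.
move=> [_ Nw] ntw.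
have iotaC := @scalar_inC F D n.+1.
have [b [s Hs]] := word_of_factors iota (gfactors w) (glast w).
have Nw' c : (forall i, N (c i)) ->
    power_central (J := eval_interpretation iotaC c)
      (icoef (eval_interpretation iotaC c) (uval b)
       * ival (eval_interpretation iotaC c) s).
  move=> Nc; have [p p0 [k Hk]] := Nw c Nc; exists p => //; exists k.
  by rewrite -Hs -gmon_evalE.
have [[s' [s'0 cyc Hs']]|[b' Hb']] := cyclic_reduction iotaC b s.
  have [c Nc Hc] := word_not_power_central iotaC generic asN Na na centerP Func
    deg s'0 cyc.
  have [p p0 [k Hk]] := proj1 (Hs' _) (Nw' c Nc).
  by apply: (Hc p p0); exists k; rewrite -(ival_eval iotaC) Hk.
(* Evaluation at the constant tuple [a] gives [b'] a central power, and the same reduction carries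
   this to the formal monomial. *)
have [p p0 [k Hk]] := proj1 (Hb' _) (Nw' (fun=> a) (fun=> Na)).
have /(proj2 (Hb' _))[q q0 [l Hl]] :
    power_central (J := gen_interpretation D n.+1 m) (icoef _ (uval b')).
  by exists p => //; exists k; rewrite -rmorphXn; congr (icoef _ _).
by apply: (ntw q q0 (iota l)); rewrite gmon_eltE Hs.
Qed.

End Main.

Theorem theorem4p6 (F : fieldType) (D : unitAlgType F) (n : nat)
    (N : set (units 'M[D]_n)) :
  division_ring D ->
  ring_center D = [set k%:A | k in [set: F]] ->
  is_algebraic D ->
  ~ countable [set: F] ->
  (0 < n)%N ->
  almost_subnormal N ->
  (exists (m : nat) (w : gmon D n m), GPCGI N w /\ nontrivial_gmon w) ->
  forall x : units 'M[D]_n, N x -> central_mx (uval x).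
Proof.
move=> divD centerD algD Func n0 asN [m [w [Nw ntw]]] a Na;
  apply: contrapT => na.
have Finf : infinite_set [set: F] by move=> /finite_set_countable.
case: n n0 N asN w Nw ntw a Na na => // -[|n] _ N asN w Nw ntw a Na na.
  have iotaC := @scalar_inC F D 1.
  have centerP := @scalar_in_center1 F D centerD.
  have divA := mx11_div divD.
  have algA M := mx11_algebraic M algD.
  (* For n = 1 the noncentral algebraic element behind the generic units is [a] itself. *)
  have [r r0 ra] := algA (uval a).
  apply: (no_nontrivial_GPCGI Func centerP _ _ asN Na na Nw ntw).
    exact: generic_unit iotaC centerP Finf _ _ na r0 ra.
  exact: (degeneration_division iotaC centerP Finf divA algA).
have iotaC := @scalar_inC F D n.+2.
have centerP M := @scalar_in_center2 F D centerD n M Finf.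
apply: (no_nontrivial_GPCGI Func centerP _ _ asN Na na Nw ntw).
  (* For n > 1 that element is a noncentral idempotent, a root of X^2 - X. *)
  pose e : 'M[D]_n.+2 := delta_mx 0 0.
  apply: (@generic_unit _ _ _ iotaC centerP Finf e ('X^2 - 'X)).
  - move=> [k /matrixP ek]; have := ek 0 0; have := ek ord_max ord_max.
    by rewrite !mxE !eqxx /= !mulr1n => <- /eqP; rewrite oner_eq0.
  - by rewrite -size_poly_eq0 size_polyDl size_polyXn // size_polyN size_polyX.
  by rewrite rmorphB /= map_polyXn map_polyX hornerD hornerN hornerXn hornerX
    expr2 delta0_idem subrr.
apply: (degeneration_idempotent iotaC Finf (@delta0_idem _ D n)).
- exact: delta0_corner.
- exact: delta0_faithful.
- by move=> M; apply: noncentral_moves.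
Qed.
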